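(* Let $\alpha>0$, suppose that $(g_j)_{j\in\mathbb{N}}$ has qualification $\overline{\nu}\in(0,\infty]$, and suppose that for every $j\in\mathbb{N}$ the function $\lambda\mapsto\lambda g_j(\lambda)$ is Lipschitz continuous on $[0,\kappa^2]$ with Lipschitz constant bounded by $j$. Put $\beta=\min\{\alpha,\overline{\nu}\}$. Then there is a constant $C>0$, depending only on $\alpha$, $\overline{\nu}$ and the constants $C_\nu$ in the qualification condition, such that for every $f\in T^\alpha\mathcal{H}$, every integer $N\ge 1$ and every $t>0$, with probability higher than $1-2e^{-t}$ over the i.i.d. samples $x_1,\dots,x_N\sim\rho$, $$\Big\| f-\sum_{j\le N^{\frac{1}{2\beta+2}}}\frac1N\sum_{i=1}^N\langle f,\widehat\psi_{j,x_i}\rangle\,\widehat\psi_{j,x_i}\Big\|\le C\,\|T^{-\alpha}f\|\,\big(\kappa^{2(\alpha-\beta)}+\kappa^{2\alpha+2}\sqrt t\,\big)\,N^{-\frac{\beta}{2\beta+2}} .$$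
   Context: Here $\mathbb{N}=\{0,1,2,\dots\}$. Let $\mathcal{X}$ be a locally compact, second countable topological space with a Borel probability measure $\rho$ such that $\operatorname{supp}(\rho)=\mathcal{X}$. Let $K:\mathcal{X}\times\mathcal{X}\to\mathbb{C}$ be a continuous positive semi-definite kernel with $\sup_{x\in\mathcal{X}}K(x,x)\le\kappa^2$, $\kappa>0$, and let $\mathcal{H}$ be its reproducing kernel Hilbert space, with $K_x=K(\cdot,x)\in\mathcal{H}$ and $f(x)=\langle f,K_x\rangle$ for $f\in\mathcal{H}$; $\|\cdot\|$ is the norm of $\mathcal{H}$. The integral operator $T:\mathcal{H}\to\mathcal{H}$, $Tf(x)=\int_{\mathcal{X}}K(x,y)f(y)\,d\rho(y)$, is positive, self-adjoint and trace class with spectrum in $[0,\kappa^2]$, and it is injective since $\operatorname{supp}(\rho)=\mathcal{X}$. Powers and functions of $T$ are defined by spectral calculus; for $f\in T^\alpha\mathcal{H}$, $T^{-\alpha}f$ is the unique $h\in\mathcal{H}$ with $T^\alpha h=f$. Spectral functions: $(g_j)_{j\in\mathbb{N}}$ is a family of functions $g_j:[0,\infty)\to[0,\infty)$ with $0\le g_j\le g_{j+1}$ for all $j$ and $\lim_{j\to\infty}\lambda g_j(\lambda)=1$ for every $\lambda\in(0,\kappa^2]$. The associated filters are $G_0(\lambda)=\sqrt{g_0(\lambda)}$ and $G_{j+1}(\lambda)=\sqrt{g_{j+1}(\lambda)-g_j(\lambda)}$, assumed to be bounded measurable functions; they satisfy $\sum_{j\in\mathbb{N}}\lambda G_j(\lambda)^2=1$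 for $\lambda\in(0,\kappa^2]$. Qualification: $(g_j)$ has qualification $\overline{\nu}\in(0,\infty]$ if for every $\nu>0$ there is a constant $C_\nu>0$ such that $\sup_{\lambda\in(0,\kappa^2]}\lambda^\nu(1-\lambda g_j(\lambda))\le C_\nu\, j^{-\min\{\nu,\overline{\nu}\}}$ for all $j\ge1$. Given i.i.d. samples $x_1,\dots,x_N\sim\rho$, the empirical integral operator $\widehat T:\mathcal{H}\to\mathcal{H}$ is $\widehat Tf(x)=\frac1N\sum_{i=1}^N K(x,x_i)f(x_i)$ (positive, self-adjoint, finite rank, spectrum in $[0,\kappa^2]$), and the Monte Carlo wavelets are $\widehat\psi_{j,x_i}=G_j(\widehat T)K_{x_i}$ for $j\in\mathbb{N}$, $i=1,\dots,N$. *)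

(* Defs.v *)
From HB Require Import structures.
From mathcomp Require Import all_boot all_order all_algebra.
From mathcomp Require Import complex.
From mathcomp Require Import all_classical all_reals all_analysis.

Set Implicit Arguments.
Unset Strict Implicit.
Unset Printing Implicit Defensive.

Import Order.TTheory GRing.Theory Num.Theory.
Import numFieldNormedType.Exports.

Local Open Scope classical_set_scope.
Local Open Scope complex_scope.
Local Open Scope ring_scope.

Notation borel X := (g_sigma_algebraType (@open X)).

(* The compact neighbourhood is not required to be closed: this agrees with
   [locally_compact setT] in Hausdorff spaces and is weaker in general. *)
Definition locally_compact_space (X : topologicalType) : Prop :=
  forall x : X, exists2 U, nbhs x U & compact U.

Definition measure_support (R : realType) (X : ptopologicalType)
    (rho : probability (borel X) R) : set X :=
  [set x | forall U : set X, open U -> U x -> (0 < rho U)%E].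

(* [0 <= z] in R[i] says that z is real and nonnegative, so this forces K to
   be Hermitian. *)
Definition psd_kernel (R : realType) (X : Type) (K : X -> X -> R[i]) : Prop :=
  forall (n : nat) (x : 'I_n -> X) (c : 'I_n -> R[i]),
    0 <= \sum_(i < n) \sum_(j < n) c i * (c j)^* * K (x i) (x j).

Definition continuous_kernel (R : realType) (X : topologicalType)
    (K : X -> X -> R[i]) : Prop :=
  continuous (fun p : X * X => K p.1 p.2 : R[i]^o).

(* The carrier is an abstract Hilbert space, identified with a space of
   functions on X through the injection [rkhs_fun].  The inner product is
   linear in its first argument; linearity of [rkhs_fun] follows from
   [rkhs_reproducing].  The norm takes (real) values in R[i]. *)
Record rkhs (R : realType) (X : Type) (K : X -> X -> R[i]) := Rkhs {
  rkhs_space :> completeNormedModType R[i] ;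
  rkhs_inner : {dot rkhs_space for (@Num.conj R[i])} ;
  rkhs_norm : forall f : rkhs_space, `|f| ^+ 2 = rkhs_inner f f ;
  rkhs_fun : rkhs_space -> X -> R[i] ;
  rkhs_fun_inj : injective rkhs_fun ;
  rkhs_section : X -> rkhs_space ;
  rkhs_sectionE : forall x y, rkhs_fun (rkhs_section x) y = K y x ;
  rkhs_reproducing :
    forall f x, rkhs_fun f x = rkhs_inner f (rkhs_section x)
}.

Definition cintegral (R : realType) d (Y : measurableType d)
    (mu : {measure set Y -> \bar R}) (F : Y -> R[i]) : R[i] :=
  (\int[mu]_y complex.Re (F y)) +i* (\int[mu]_y complex.Im (F y)).

Definition is_integral_operator (R : realType) (X : ptopologicalType)
    (rho : probability (borel X) R) (K : X -> X -> R[i]) (H : rkhs K)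
    (T : H -> H) : Prop :=
  forall (f : H) (x : X),
    rkhs_fun (T f) x = cintegral rho (fun y => K x y * rkhs_fun f y).

(* The element of H given by y |-> N^-1 * sum_i K(y, x_i) f(x_i). *)
Definition empirical_operator (R : realType) (X : Type) (K : X -> X -> R[i])
    (H : rkhs K) (N : nat) (x : 'I_N -> X) (f : H) : H :=
  N%:R^-1 *: \sum_(i < N) rkhs_fun f (x i) *: rkhs_section H (x i).

Section spectral_calculus.
Context (R : realType) (X : Type) (K : X -> X -> R[i]) (H : rkhs K).

Definition orthogonal_projection (E : H -> H) : Prop :=
  [/\ linear E, forall f, E (E f) = E f &
      forall f g, rkhs_inner H (E f) g = rkhs_inner H f (E g)].

(* Discrete spectral resolution id = sum_n E_n, A = sum_n lam_n E_n (strong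
   convergence), which every compact self-adjoint operator has.  Some E_n may
   vanish, and the lam_n may repeat. *)
Definition spectral_resolution (A : H -> H) (lam : nat -> R)
    (E : nat -> H -> H) : Prop :=
  [/\ forall n, orthogonal_projection (E n),
      forall m n f, m <> n -> E m (E n f) = 0,
      forall f, series (fun n => E n f) @ \oo --> f &
      forall f, series (fun n => (lam n)%:C *: E n f) @ \oo --> A f].

(* F(A) = sum_n F(lam_n) E_n; the value does not depend on the resolution. *)
Definition spectral_calculus (F : R -> R) (A : H -> H) (f : H) : H :=
  xget 0 [set g | exists lam E, spectral_resolution A lam E /\
    series (fun n => (F (lam n))%:C *: E n f) @ \oo --> g].

Definition operator_power (A : H -> H) (a : R) : H -> H :=
  spectral_calculus (fun l => l `^ a) A.

Definition operator_inverse (A : H -> H) (f : H) : H :=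
  xget 0 [set h | A h = f].

End spectral_calculus.

Section spectral_functions.
Context (R : realType).
Implicit Types (kappa : R) (g : nat -> R -> R).

(* Only the values of g j on [0, +oo[ are constrained. *)
Definition spectral_functions kappa g : Prop :=
  (forall j l, 0 <= l -> 0 <= g j l <= g j.+1 l) /\
  (forall l, 0 < l <= kappa ^+ 2 -> (l * g j l) @[j --> \oo] --> (1 : R)).

Definition filter_fun g (j : nat) (l : R) : R :=
  if j is k.+1 then Num.sqrt (g k.+1 l - g k l) else Num.sqrt (g 0 l).

Definition bounded_measurable_filters g : Prop :=
  forall j, measurable_fun (`[0, +oo[%classic : set R) (filter_fun g j) /\
            [bounded filter_fun g j l | l in `[0, +oo[%classic].

Definition min_qual (nu : R) (nubar : \bar R) : R := fine (mine nu%:E nubar).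

(* Qualification nubar, with constants Cq nu. *)
Definition qualification kappa g (nubar : \bar R) (Cq : R -> R) : Prop :=
  forall nu, 0 < nu -> 0 < Cq nu /\
    forall j l, (1 <= j)%N -> 0 < l <= kappa ^+ 2 ->
      l `^ nu * (1 - l * g j l) <= Cq nu * j%:R `^ (- min_qual nu nubar).

End spectral_functions.

Definition mc_wavelet (R : realType) (X : Type) (K : X -> X -> R[i])
    (H : rkhs K) (g : nat -> R -> R) (N : nat) (x : 'I_N -> X) (j : nat)
    (i : 'I_N) : H :=
  spectral_calculus (filter_fun g j) (@empirical_operator R X K H N x)
    (rkhs_section H (x i)).

Definition mc_reconstruction (R : realType) (X : Type) (K : X -> X -> R[i])
    (H : rkhs K) (g : nat -> R -> R) (N : nat) (x : 'I_N -> X) (tau : R)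
    (f : H) : H :=
  \sum_(0 <= j < (Num.truncn tau).+1)
    N%:R^-1 *: \sum_(i < N)
      rkhs_inner H f (mc_wavelet H g x j i) *: mc_wavelet H g x j i.

Definition iid_samples (R : realType) (X : ptopologicalType)
    (rho : probability (borel X) R) d (Omega : measurableType d)
    (P : probability Omega R) (N : nat) (x : 'I_N -> Omega -> X) : Prop :=
  [/\ forall i, measurable_fun setT (x i : Omega -> borel X),
      forall i (B : set (borel X)), measurable B ->
        P (x i @^-1` B) = rho B &
      forall (B : 'I_N -> set (borel X)) (J : {set 'I_N}),
        (forall i, measurable (B i)) ->
        P (\bigcap_(i in [set` J]) (x i @^-1` B i)) =
          (\prod_(i in J) P (x i @^-1` B i))%E].

(* Main.v *)
Require Import Defs.
From HB Require Import structures.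
From mathcomp Require Import all_boot all_order all_algebra.
From mathcomp Require Import complex.
From mathcomp Require Import all_classical all_reals all_analysis.
From mathcomp Require Import measurable_realfun ring lra.

(** The squared filters telescope, sum_(j <= J) G_j^2 = g_J, so the
    reconstruction with J = floor (N^(1/(2beta+2))) is F(That) f for the single
    function F(l) = l * g_J(l) of the empirical operator That
    (proj_reconstruction).  With f = T^alpha h the error splits as

      (1 - F(T)) T^alpha h  +  (F(T) - F(That)) f.

    The first term is a bias: eigenvalue by eigenvalue, the qualification at
    exponent beta bounds it by a multiple of kappa^(2(alpha-beta)) J^(-beta)
    |h| (scalar_bias).  The second is a variance: F is J-Lipschitz, and between
    an eigenspace E_n of T and an eigenspace F_m of That the difference
    F(T) - F(That) acts as F(lam_n) - F(mu_m) while T - That acts as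
    lam_n - mu_m, so the variance is at most J |f| times the Hilbert-Schmidt
    distance of T and That (calculus_stability; error_split adds the two
    terms).  That distance is O(kappa^2 sqrt(t/N)) with probability larger than
    1 - 2e^(-t) (energy_tail), and the choice of J balances J^(-beta) against
    J / sqrt N (truncn_rate, rate_combination).

    Hilbert-Schmidt norms enter through finite point configurations only.  An
    operator v |-> sum_i c_i <v, K_(z_i)> K_(z_i) has squared Hilbert-Schmidt
    norm sum_(i,j) c_i c_j |K(z_i, z_j)|^2, a quadratic form of the kernel
    |K|^2, and this number bounds the sum of the |A e_m|^2 over every
    orthonormal family (hs_bessel).  The operator T is reached as a strong limit
    of such operators: choosing points one at a time so that the new cross term
    is nonpositive, which is possible because it averages to zero for the
    centered kernel, produces configurations whose empirical operators are at
    distance O(1 / sqrt n) from T (herding, sampling_cvg).  The bounds on the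
    eigenvalues of T and on its distance to That pass to this limit
    (integral_operator_eig_bound, integral_operator_hs).

    For the same centered kernel, N^2 times the squared distance of T and That
    is the sum V of the kernel over all pairs of samples.  Adding a sample
    changes V by a diagonal term and by a cross term of conditional mean zero
    and of square at most 4 M V; e^u <= u + e^(2u^2) therefore bounds the
    exponential moment of V recursively (conditional_mgf, mgf_energy), and the
    Markov inequality gives the tail.  The event of the theorem is measurable
    because the error depends continuously on the samples, whose space has a
    countable base (reconstruction_error_measurable). *)

Set Implicit Arguments.
Unset Strict Implicit.
Unset Printing Implicit Defensive.

Import Order.TTheory GRing.Theory Num.Theory.
Import numFieldNormedType.Exports.

Local Open Scope classical_set_scope.
Local Open Scope complex_scope.
Local Open Scope ring_scope.

(** * Means of bounded measurable functions *)

Section bounded_measurable.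
Context (R : realType) d (Y : measurableType d) (rho : probability Y R).
Implicit Types (g h : Y -> R).

Definition bounded_mfun g : Prop :=
  measurable_fun setT g /\ exists M, forall y, `|g y| <= M.

Local Notation "'E[ g ]" := (\int[rho]_y g y) (at level 0, format "''E[' g ]").

Lemma bounded_mfun_integrable g :
  bounded_mfun g -> rho.-integrable setT (EFin \o g).
Proof.
move=> [mg [M gM]]; apply: measurable_bounded_integrable => //.
  by rewrite [X in (X < _)%E](@probability_setT _ _ _ rho) ltry.
by exists M; split; [exact: num_real|move=> N MN y _ /=; apply: le_trans (gM y) (ltW MN)].
Qed.

Lemma bounded_mfun_cst c : bounded_mfun (fun=> c).
Proof. by split; [exact: measurable_cst|exists `|c|]. Qed.

Lemma bounded_mfunD g h : bounded_mfun g -> bounded_mfun h ->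
  bounded_mfun (fun y => g y + h y).
Proof.
move=> [mg [M gM]] [mh [N hN]]; split; first exact: measurable_funD.
by exists (M + N) => y; apply: le_trans (ler_normD _ _) _; exact: lerD.
Qed.

Lemma bounded_mfunM g h : bounded_mfun g -> bounded_mfun h ->
  bounded_mfun (fun y => g y * h y).
Proof.
move=> [mg [M gM]] [mh [N hN]]; split; first exact: measurable_funM.
by exists (M * N) => y; rewrite normrM ler_pM.
Qed.

Lemma bounded_mfunZ c g : bounded_mfun g -> bounded_mfun (fun y => c * g y).
Proof. exact: bounded_mfunM (bounded_mfun_cst c). Qed.

Lemma bounded_mfun_sum I (r : seq I) (g : I -> Y -> R) :
  (forall i, bounded_mfun (g i)) -> bounded_mfun (fun y => \sum_(i <- r) g i y).
Proof.
move=> gb; elim: r => [|i r IH].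
  by under eq_fun do rewrite big_nil; exact: bounded_mfun_cst.
by under eq_fun do rewrite big_cons; exact: bounded_mfunD.
Qed.

Lemma mean_cst c : \int[rho]_y c = c :> R.
Proof. by rewrite Rintegral_cst // [X in fine X](@probability_setT _ _ _ rho) mulr1. Qed.

Lemma meanD g h : bounded_mfun g -> bounded_mfun h ->
  \int[rho]_y (g y + h y) = \int[rho]_y g y + \int[rho]_y h y.
Proof. by move=> gb hb; rewrite RintegralD //; exact: bounded_mfun_integrable. Qed.

Lemma meanZ c g : bounded_mfun g ->
  \int[rho]_y (c * g y) = c * \int[rho]_y g y.
Proof. by move=> gb; rewrite RintegralZl //; exact: bounded_mfun_integrable. Qed.

Lemma mean_sum I (r : seq I) (g : I -> Y -> R) :
  (forall i, bounded_mfun (g i)) ->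
  \int[rho]_y (\sum_(i <- r) g i y) = \sum_(i <- r) \int[rho]_y g i y.
Proof.
move=> gb; elim: r => [|i r IH].
  by rewrite big_nil; under eq_Rintegral do rewrite big_nil; exact: mean_cst.
rewrite big_cons -IH -meanD //; last exact: bounded_mfun_sum.
by apply: eq_Rintegral => y _; rewrite big_cons.
Qed.

Lemma mean_le g h : bounded_mfun g -> bounded_mfun h -> (forall y, g y <= h y) ->
  \int[rho]_y g y <= \int[rho]_y h y.
Proof.
by move=> gb hb gh; apply: le_Rintegral => //; exact: bounded_mfun_integrable.
Qed.

(** A positive function of mean zero would vanish almost everywhere. *)
Lemma exists_le_mean0 g : bounded_mfun g -> \int[rho]_y g y = 0 ->
  exists y, g y <= 0.
Proof.
move=> gb g0; apply/not_existsP => gpos.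
have gp y : 0 < g y by rewrite ltNge; apply/negP/gpos.
have gi := bounded_mfun_integrable gb.
have : (\int[rho]_y `|(g y)%:E| = 0)%E.
  transitivity (\int[rho]_y (g y)%:E)%E.
    by apply: eq_integral => y _; rewrite gee0_abs // lee_fin ltW.
  have fi : (\int[rho]_y (g y)%:E)%E \is a fin_num by exact: integrable_fin_num.
  by rewrite -(fineK fi) -/(Rintegral _ _ _) g0.
have [mg _] := gb.
move/(ae_eq_integral_abs rho measurableT (f := EFin \o g)).
move=> /(_ _)[]; first exact/measurable_EFinP.
move=> A [mA A0 sA].
have : (rho setT <= rho A)%E.
  apply: le_measure; rewrite ?inE // => y _; apply: sA => /= h.
  by have := h I => -[gy0]; have := gp y; rewrite gy0 ltxx.
by rewrite A0 [X in (X <= _)%E](@probability_setT _ _ _ rho) lee_fin ler10.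
Qed.

End bounded_measurable.

(** * Quadratic forms of weighted point configurations *)

Section weighted_points.
Context (R : realType) (Y : Type).
Implicit Types (phi : Y -> Y -> R) (s t : seq (R * Y)).

Definition quad_form phi s : R :=
  \sum_(p <- s) \sum_(q <- s) p.1 * q.1 * phi p.2 q.2.

Definition mass s : R := \sum_(p <- s) p.1.

(** The opposite signed configuration: [s ++ negw t] stands for the difference
    of the measures carried by [s] and [t]. *)
Definition negw s : seq (R * Y) := [seq (- p.1, p.2) | p <- s].

Definition bilin_form phi s t : R :=
  \sum_(p <- s) \sum_(q <- t) p.1 * q.1 * phi p.2 q.2.

Lemma bilin_form_sym phi s t : (forall x y, phi x y = phi y x) ->
  bilin_form phi s t = bilin_form phi t s.
Proof.
move=> phiC; rewrite /bilin_form exchange_big; apply: eq_bigr => q _ /=.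
by apply: eq_bigr => p _; rewrite phiC [q.1 * _]mulrC.
Qed.

Lemma quad_form_cat phi s t : (forall x y, phi x y = phi y x) ->
  quad_form phi (s ++ t) =
  quad_form phi s + quad_form phi t + 2 * bilin_form phi s t.
Proof.
move=> phiC; rewrite {1}/quad_form big_cat /=.
have E u : \sum_(p <- u) \sum_(q <- s ++ t) p.1 * q.1 * phi p.2 q.2
    = bilin_form phi u s + bilin_form phi u t.
  by rewrite -big_split; apply: eq_bigr => p _; rewrite big_cat.
rewrite !E (bilin_form_sym t s phiC).
rewrite -[quad_form phi s]/(bilin_form phi s s) -[quad_form phi t]/(bilin_form phi t t).
ring.
Qed.

Lemma quad_form_cons phi s a y : (forall x y, phi x y = phi y x) ->
  quad_form phi ((a, y) :: s) =
  quad_form phi s + 2 * a * (\sum_(q <- s) q.1 * phi q.2 y) + a ^+ 2 * phi y y.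
Proof.
move=> phiC; rewrite -cat1s quad_form_cat //.
have -> : quad_form phi [:: (a, y)] = a ^+ 2 * phi y y.
  by rewrite /quad_form !big_seq1 expr2.
have -> : bilin_form phi [:: (a, y)] s = a * (\sum_(q <- s) q.1 * phi q.2 y).
  rewrite /bilin_form big_seq1 mulr_sumr; apply: eq_bigr => q _ /=.
  by rewrite phiC mulrA.
ring.
Qed.

Lemma quad_form_neg phi s : quad_form phi (negw s) = quad_form phi s.
Proof.
rewrite /quad_form big_map; apply: eq_bigr => p _; rewrite big_map.
by apply: eq_bigr => q _ /=; rewrite mulrNN.
Qed.

Lemma bilin_form_neg phi s t : bilin_form phi s (negw t) = - bilin_form phi s t.
Proof.
rewrite /bilin_form -sumrN; apply: eq_bigr => p _; rewrite big_map -sumrN.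
by apply: eq_bigr => q _ /=; rewrite mulrN mulNr.
Qed.

(** The parallelogram inequality for the seminorm of a positive kernel. *)
Lemma quad_form_diff_le2 phi s t : (forall x y, phi x y = phi y x) ->
  (forall s, 0 <= quad_form phi s) ->
  quad_form phi (s ++ negw t) <= 2 * quad_form phi s + 2 * quad_form phi t.
Proof.
move=> phiC phi0; have := phi0 (s ++ t).
rewrite !quad_form_cat // quad_form_neg bilin_form_neg; lra.
Qed.

Lemma mass_cat s t : mass (s ++ t) = mass s + mass t.
Proof. by rewrite /mass big_cat. Qed.

Lemma mass_const a (z : seq Y) : mass [seq (a, y) | y <- z] = a * (size z)%:R.
Proof.
rewrite /mass big_map /=; elim: z => [|y z IH]; first by rewrite big_nil mulr0.
by rewrite big_cons IH /= -add1n natrD mulrDr mulr1.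
Qed.

Lemma mass_neg s : mass (negw s) = - mass s.
Proof. by rewrite /mass big_map sumrN. Qed.

End weighted_points.

(** * Geometry of the Hilbert space *)

Section rkhs_geometry.
Context (R : realType) (X : Type) (K : X -> X -> R[i]) (H : rkhs K).
Implicit Types (u v w f : H) (a : R[i]).

Local Notation "'[ u , v ]" := (rkhs_inner H u v) : ring_scope.

Definition sqn u : R := complex.Re '[u, u].

Definition abs2 (z : R[i]) : R := complex.Re z ^+ 2 + complex.Im z ^+ 2.

Lemma abs2E (z : R[i]) : (abs2 z)%:C = `|z| ^+ 2.
Proof. by rewrite /abs2 add_Re2_Im2. Qed.

Lemma abs2_conj (z : R[i]) : (abs2 z)%:C = z * z^*.
Proof. by rewrite abs2E normCK. Qed.

Lemma abs2_ge0 z : 0 <= abs2 z.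
Proof. by rewrite addr_ge0 ?sqr_ge0. Qed.

Lemma abs2M z z' : abs2 (z * z') = abs2 z * abs2 z'.
Proof. case: z z' => [a b] [c d]; rewrite /abs2 /=; ring. Qed.

Lemma abs2C z : abs2 z^* = abs2 z.
Proof. by case: z => [a b]; rewrite /abs2 /= sqrrN. Qed.

Lemma abs2_real (r : R) : abs2 r%:C = r ^+ 2.
Proof. by rewrite /abs2 /= expr0n addr0. Qed.

Lemma conjC_real (r : R) : (r%:C)^* = r%:C.
Proof. exact: conjc_real. Qed.

Lemma Re_sum I (r : seq I) (F : I -> R[i]) :
  complex.Re (\sum_(i <- r) F i) = \sum_(i <- r) complex.Re (F i).
Proof. exact: (raddf_sum (@complex.Re R : Rcomplex R -> R)). Qed.

Lemma Im_sum I (r : seq I) (F : I -> R[i]) :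
  complex.Im (\sum_(i <- r) F i) = \sum_(i <- r) complex.Im (F i).
Proof. exact: (raddf_sum (@complex.Im R : Rcomplex R -> R)). Qed.

Lemma ipC u v : '[v, u] = '[u, v]^*.
Proof. by rewrite hermC /= expr0 mul1r. Qed.

Lemma ipDl u v w : '[u + v, w] = '[u, w] + '[v, w].
Proof. by rewrite linearDl. Qed.
Lemma ipDr u v w : '[w, u + v] = '[w, u] + '[w, v].
Proof. by rewrite linearDr. Qed.
Lemma ipBl u v w : '[u - v, w] = '[u, w] - '[v, w].
Proof. by rewrite linearBl. Qed.
Lemma ipBr u v w : '[w, u - v] = '[w, u] - '[w, v].
Proof. by rewrite linearBr. Qed.
Lemma ipZl a u v : '[a *: u, v] = a * '[u, v].
Proof. by rewrite linearZl_LR. Qed.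
Lemma ipZr a u v : '[u, a *: v] = a^* * '[u, v].
Proof. by rewrite linearZr_LR. Qed.
Lemma ip0l u : '[0, u] = 0. Proof. by rewrite linear0l. Qed.
Lemma ip0r u : '[u, 0] = 0. Proof. by rewrite linear0r. Qed.
Lemma ip_suml I (r : seq I) P (F : I -> H) v :
  '[\sum_(i <- r | P i) F i, v] = \sum_(i <- r | P i) '[F i, v].
Proof. by rewrite linear_sumlz. Qed.
Lemma ip_sumr I (r : seq I) P (F : I -> H) v :
  '[v, \sum_(i <- r | P i) F i] = \sum_(i <- r | P i) '[v, F i].
Proof. by rewrite linear_sumr. Qed.

Lemma ip_self u : '[u, u] = (sqn u)%:C.
Proof.
rewrite /sqn RRe_real // ger0_real //; exact: dnorm_ge0.
Qed.

Lemma sqn_ge0 u : 0 <= sqn u.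
Proof. by rewrite -lecR -ip_self; exact: dnorm_ge0. Qed.

Lemma sqn_eq0 u : sqn u = 0 -> u = 0.
Proof.
move=> u0; apply/eqP; rewrite -(dnorm_eq0 (rkhs_inner H)).
by rewrite ip_self u0.
Qed.

Lemma sqn0 : sqn 0 = 0. Proof. by rewrite /sqn ip0l. Qed.

Lemma sqnN u : sqn (- u) = sqn u.
Proof. by rewrite /sqn hnormN. Qed.

Lemma sqnZ a u : sqn (a *: u) = abs2 a * sqn u.
Proof.
apply: complexI; rewrite -ip_self ipZl ipZr mulrA -abs2_conj ip_self.
by rewrite -rmorphM.
Qed.

Lemma sqnD u v : sqn (u + v) = sqn u + sqn v + 2 * complex.Re '[u, v].
Proof.
rewrite /sqn ipDl !ipDr (ipC u v) /=.
case: ('[u, v]) => a b /=; case: '[u, u] => ? ? /=; case: '[v, v] => ? ? /=.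
lra.
Qed.

Lemma norm_sqnE u : `|u| = (Num.sqrt (sqn u))%:C.
Proof.
apply/eqP; rewrite -(@eqrXn2 _ 2) //; last first.
  by rewrite ler0c sqrtr_ge0.
by rewrite rkhs_norm -rmorphXn /= sqr_sqrtr ?sqn_ge0 // ip_self.
Qed.

(** Lets convergence statements about imaginary parts follow from those about
    real parts. *)
Lemma im_ip (u v : H) : complex.Im '[u, v] = complex.Re '[u, 'i%C *: v].
Proof. by rewrite ipZr; case: '[u, v] => a b /=; ring. Qed.

Lemma cauchy_schwarz u v : abs2 '[u, v] <= sqn u * sqn v.
Proof.
have [->|v0] := eqVneq v 0; first by rewrite ip0r sqn0 mulr0 /abs2 !expr0n addr0.
have vv0 : 0 < sqn v.
  by rewrite lt_def sqn_ge0 andbT; apply: contra_neq v0; exact: sqn_eq0.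
have := sqn_ge0 ((sqn v)%:C *: u + (- '[u, v]) *: v).
rewrite sqnD !sqnZ abs2_real ipZl ipZr.
have -> : complex.Re ((sqn v)%:C * ((- '[u, v])^* * '[u, v]))
         = - sqn v * abs2 '[u, v].
  by rewrite /abs2; case: '[u, v] => a b /=; ring.
have -> : abs2 (- '[u, v]) = abs2 '[u, v].
  by rewrite /abs2; case: '[u, v] => a b /=; rewrite !sqrrN.
move=> h; rewrite -subr_ge0 -(pmulr_rge0 _ vv0); apply: le_trans h _.
by rewrite le_eqVlt; apply/orP; left; apply/eqP; ring.
Qed.

Lemma re_ip_le u v : complex.Re '[u, v] ^+ 2 <= sqn u * sqn v.
Proof.
by apply: le_trans (cauchy_schwarz u v); rewrite /abs2 lerDl sqr_ge0.
Qed.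

Lemma sqnD_le2 u v : sqn (u + v) <= 2 * sqn u + 2 * sqn v.
Proof.
have := sqn_ge0 (u - v); rewrite !sqnD sqnN -scaleN1r ipZr.
rewrite rmorphN rmorph1 mulN1r.
case: '[u, v] => a b /=; lra.
Qed.

Lemma sqrt_sqnD (u v : H) : Num.sqrt (sqn (u + v)) <= Num.sqrt (sqn u) + Num.sqrt (sqn v).
Proof. by rewrite -lecR rmorphD /= -!norm_sqnE; exact: ler_normD. Qed.

(** Norms at most one suffice, which admits zero vectors in the family. *)
Lemma bessel (n : nat) (e : 'I_n -> H) v :
  (forall i j, i != j -> '[e i, e j] = 0) ->
  (forall i, sqn (e i) <= 1) ->
  \sum_(i < n) abs2 '[v, e i] <= sqn v.
Proof.
move=> eo e1; pose p := \sum_(i < n) '[v, e i] *: e i.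
have vp : '[v, p] = (\sum_(i < n) abs2 '[v, e i])%:C.
  rewrite ip_sumr rmorph_sum /=; apply: eq_bigr => i _.
  by rewrite ipZr abs2_conj mulrC.
have pp : sqn p <= \sum_(i < n) abs2 '[v, e i].
  rewrite -lecR -ip_self {1}/p ip_suml rmorph_sum; apply: ler_sum => i _.
  rewrite ipZl /p ip_sumr (bigD1 i) //= big1 ?addr0; last first.
    by move=> j ji; rewrite ipZr eo ?mulr0 // eq_sym.
  rewrite ipZr mulrA -abs2_conj ip_self -rmorphM lecR /=.
  by rewrite ler_piMr ?abs2_ge0.
have := sqn_ge0 (v - p); rewrite sqnD sqnN -scaleN1r ipZr vp.
rewrite rmorphN rmorph1 mulN1r /= => h.
lra.
Qed.

End rkhs_geometry.

(** * Diagonalizing a Gram matrix *)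

Section gram.
Context (R : realType) (X : Type) (K : X -> X -> R[i]) (H : rkhs K).
Implicit Types (u v w f : H) (a : R[i]).
Local Notation "'[ u , v ]" := (rkhs_inner H u v) : ring_scope.

(** Zero vectors are admitted, so that normalizing an orthogonal family never
    requires discarding or reindexing its members. *)
Definition orthonormal0 (n : nat) (e : 'I_n -> H) : Prop :=
  (forall i j, i != j -> '[e i, e j] = 0) /\
  (forall i, sqn (e i) = (e i != 0)%:R).

Definition unit_vec u : H := ((Num.sqrt (sqn u))^-1)%:C *: u.

Lemma sqn_gt0 u : u != 0 -> 0 < sqn u.
Proof.
by move=> u0; rewrite lt_def sqn_ge0 andbT; apply: contra_neq u0; exact: sqn_eq0.
Qed.

Lemma unit_vecE u : u = (Num.sqrt (sqn u))%:C *: unit_vec u.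
Proof.
have [->|u0] := eqVneq u 0; first by rewrite /unit_vec !scaler0.
rewrite /unit_vec scalerA -rmorphM /= divff ?rmorph1 ?scale1r //.
by rewrite sqrtr_eq0 -ltNge sqn_gt0.
Qed.

Lemma unit_vec0 : unit_vec 0 = 0.
Proof. by rewrite /unit_vec scaler0. Qed.

Lemma sqn_unit_vec u : sqn (unit_vec u) = (unit_vec u != 0)%:R.
Proof.
have [->|u0] := eqVneq u 0; first by rewrite unit_vec0 eqxx sqn0.
have : sqn (unit_vec u) = 1.
  rewrite sqnZ abs2_real exprVn sqr_sqrtr ?sqn_ge0 // mulVf //.
  by rewrite gt_eqF // sqn_gt0.
have [->|//] := eqVneq (unit_vec u) 0.
by rewrite sqn0 => /esym/eqP; rewrite oner_eq0.
Qed.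

Lemma orthonormal0_unit n (u : 'I_n -> H) :
  (forall i j, i != j -> '[u i, u j] = 0) -> orthonormal0 (unit_vec \o u).
Proof.
move=> uo; split=> [i j ij|i] /=; last exact: sqn_unit_vec.
by rewrite ipZl ipZr uo // !mulr0.
Qed.

Lemma orthonormal0_le1 n (e : 'I_n -> H) : orthonormal0 e -> forall i, sqn (e i) <= 1.
Proof. by move=> [_ e1] i; rewrite e1; case: (_ != _). Qed.

(** A unitary matrix diagonalizing the Gram matrix of the [k i] recombines them
    into orthogonal vectors whose squared norms are the eigenvalues.  Normalized,
    these give both the spectral form of [sum_i <., k_i> k_i] and an orthonormal
    basis of the span. *)
Lemma gram_diagonalization n (k : 'I_n -> H) :
  exists e : 'I_n -> H, exists d : 'I_n -> R,
  [/\ orthonormal0 e, forall j, 0 <= d j,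
      forall v, \sum_i '[v, k i] *: k i = \sum_j ((d j)%:C * '[v, e j]) *: e j &
      forall i, k i = \sum_j '[k i, e j] *: e j].
Proof.
pose G := \matrix_(i, j) '[k i, k j] : 'M[R[i]]_n.
have Gh : G \is hermsymmx.
  apply/is_hermitianmxP; rewrite expr0 scale1r; apply/matrixP => i j.
  by rewrite !mxE -ipC.
have /hermitian_normalmx/orthomx_spectralP := Gh.
have := spectral_unitarymx G.
set P := spectralmx G; set D := spectral_diag G => Pu GE.
have PPt : P *m (map_mx Num.conj P^T) = 1%:M by apply/unitarymxP.
have PtP : (map_mx Num.conj P^T) *m P = 1%:M by apply: mulmx1C.
have PtPE i j : \sum_l (P l i)^* * P l j = (i == j)%:R.
  have /matrixP/(_ i j) := PtP; rewrite !mxE => <-.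
  by apply: eq_bigr => l _; rewrite !mxE.
have PG : P *m G *m (map_mx Num.conj P^T) = diag_mx D.
  rewrite GE invmx_unitary // !mulmxA PPt mul1mx -mulmxA PPt mulmx1 //.
(* The rows of P combine the k i into an orthogonal family. *)
pose u l := \sum_i P l i *: k i.
have uu l m : '[u l, u m] = diag_mx D l m.
  rewrite -PG mxE ip_sumr; apply: eq_bigr => j _.
  rewrite ipZr ip_suml !mxE mulrC; congr (_ * _).
  by apply: eq_bigr => i _; rewrite ipZl mxE.
have ku i : k i = \sum_l (P l i)^* *: u l.
  transitivity (\sum_j (\sum_l (P l i)^* * P l j) *: k j).
    rewrite (bigD1 i) //= PtPE eqxx scale1r big1 ?addr0 // => j ji.
    by rewrite PtPE eq_sym (negPf ji) scale0r.
  under eq_bigr do rewrite scaler_suml.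
  rewrite exchange_big /=; apply: eq_bigr => l _.
  by rewrite scaler_sumr; apply: eq_bigr => j _; rewrite scalerA.
have uo : forall i j, i != j -> '[u i, u j] = 0.
  by move=> i j ij; rewrite uu mxE (negPf ij).
have oe := orthonormal0_unit uo.
exists (unit_vec \o u), (fun l => sqn (u l)); split => //.
- by move=> j; exact: sqn_ge0.
- move=> v; transitivity (\sum_l '[v, u l] *: u l).
    under eq_bigr => i _ do rewrite {2}ku scaler_sumr.
    rewrite exchange_big /=; apply: eq_bigr => l _.
    rewrite ip_sumr scaler_suml; apply: eq_bigr => i _.
    by rewrite scalerA ipZr mulrC.
  apply: eq_bigr => l _ /=.
  rewrite {1 2}(unit_vecE (u l)) ipZr scalerA conjC_real mulrAC -rmorphM /=.
  by rewrite -expr2 sqr_sqrtr ?sqn_ge0.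
- move=> i; rewrite {1}ku; apply: eq_bigr => l _ /=.
  rewrite ku ip_suml (bigD1 l) //= big1 ?addr0; last first.
    by move=> m ml; rewrite ipZl /unit_vec ipZr uo // !mulr0.
  rewrite ipZl {1 2}(unit_vecE (u l)) ipZl ip_self; case: oe => _ /(_ l) /= ->.
  rewrite scalerA; have [->|_] := eqVneq (unit_vec (u l)) 0.
    by rewrite !scaler0.
  by rewrite mulr1.
Qed.

End gram.

(** * Limits and spectral resolutions *)

Section resolution.
Context (R : realType) (X : Type) (K : X -> X -> R[i]) (H : rkhs K).
Implicit Types (u v w f : H) (a : R[i]).
Local Notation "'[ u , v ]" := (rkhs_inner H u v) : ring_scope.

(** Converts convergence for the norm of the normed module, which takes values
    in [R[i]], into convergence of real numbers. *)
Lemma cvg_sqnP (u : nat -> H) l :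
  u @ \oo --> l <-> sqn (u n - l) @[n --> \oo] --> (0 : R).
Proof.
split=> [/cvgrPdist_lt ul|/cvgrPdist_lt ul]; apply/cvgrPdist_lt => e e0.
- have r0 : (0 : R[i]) < (Num.sqrt e)%:C by rewrite ltcR sqrtr_gt0.
  near=> n; rewrite sub0r normrN ger0_norm ?sqn_ge0 //.
  rewrite -[ltRHS]sqr_sqrtr ?ltW // -[ltLHS]sqr_sqrtr ?sqn_ge0 //.
  rewrite ltr_pXn2r ?nnegrE ?sqrtr_ge0 // -ltcR -norm_sqnE -normrN opprB.
  by near: n; exact: ul.
- case: e e0 => a b; rewrite ltcE /= => /andP[/eqP -> a0].
  have a20 : 0 < a ^+ 2 by rewrite exprn_gt0.
  near=> n; rewrite -normrN opprB norm_sqnE ltcR.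
  rewrite -[ltRHS]ger0_norm ?ltW // -sqrtr_sqr ltr_sqrt //.
  rewrite -[ltLHS]ger0_norm ?sqn_ge0 // -normrN -[X in `|X|]sub0r.
  by near: n; exact: (ul _ a20).
Unshelve. all: by end_near. Qed.

Lemma squeeze0 (u h : nat -> R) : (forall n, 0 <= u n <= h n) ->
  h @ \oo --> 0 -> u @ \oo --> 0.
Proof.
move=> uh h0; apply: (squeeze_cvgr _ _ h0); last exact: cvg_cst.
by near=> n; exact: uh.
Unshelve. all: by end_near. Qed.

Lemma cvg_re_ip (u : nat -> H) l v : u @ \oo --> l ->
  complex.Re '[u n, v] @[n --> \oo] --> complex.Re '[l, v].
Proof.
move=> /cvg_sqnP ul; apply/subr_cvg0.
have h : (Num.sqrt (sqn (u n - l)) * Num.sqrt (sqn v)) @[n --> \oo] --> (0 : R).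
  rewrite -[X in _ --> X](mul0r (Num.sqrt (sqn v))).
  apply: cvgMr_tmp; rewrite -[X in _ --> X]sqrtr0.
  apply: continuous_cvg => //; exact: sqrt_continuous.
apply/cvgr0Pnorm_lt => e e0; move/cvgr0Pnorm_lt: h => /(_ e e0).
apply: filterS => n; apply: le_lt_trans.
rewrite [leRHS]ger0_norm ?mulr_ge0 ?sqrtr_ge0 // -sqrtrM ?sqn_ge0 // -sqrtr_sqr.
apply: ler_wsqrtr; apply: le_trans (re_ip_le _ _).
rewrite ipBl; case: '[u n, v] => ? ?; case: '[l, v] => ? ?.
by [].
Qed.

Lemma cvg_sqn (u : nat -> H) l : u @ \oo --> l ->
  sqn (u n) @[n --> \oo] --> sqn l.
Proof.
move=> ul; have ul0 := (cvg_sqnP _ _).1 ul.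
have -> : (fun n => sqn (u n)) = (fun n => sqn (u n - l)
   + (2 * complex.Re '[u n, l] - sqn l)).
  apply/funext => n; rewrite sqnD sqnN -scaleN1r ipZr rmorphN rmorph1 mulN1r.
  by case: '[u n, l] => a b /=; lra.
have lE : sqn l = 0 + (2 * complex.Re '[l, l] - sqn l).
  by rewrite -/(sqn l); lra.
rewrite [X in _ --> X]lE.
apply: (cvgD ul0); apply: (cvgB _ (cvg_cst _)).
by apply: cvgMl_tmp; exact: cvg_re_ip.
Qed.

Lemma cvg_le_cst (u : nat -> R) l c :
  u @ \oo --> l -> (forall n, u n <= c) -> l <= c.
Proof.
move=> ul h; apply: ler_cvg_to ul (cvg_cst c) _.
by near=> n; exact: h.
Unshelve. all: by end_near. Qed.

Lemma harmonic_bound_cvg (c e : R) :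
  (fun n => c + e / n.+1%:R) @ \oo --> c.
Proof.
rewrite -[X in _ --> X]addr0; apply: cvgD; first exact: cvg_cst.
by rewrite -[X in _ --> X](mulr0 e); apply: cvgMl_tmp; exact: cvg_harmonic.
Qed.

Lemma cvg_le_harmonic (u : nat -> R) l c e :
  u @ \oo --> l -> (forall n, u n <= c + e / n.+1%:R) -> l <= c.
Proof.
move=> ul h; have hc := @harmonic_bound_cvg c e.
have := ler_cvg_to ul hc; apply.
by near=> n; exact: h.
Unshelve. all: by end_near. Qed.

Lemma cvg_sq_harmonic (u : nat -> R) l e :
  (forall n, (u n - l) ^+ 2 <= e / n.+1%:R) -> u @ \oo --> l.
Proof.
move=> h; apply/subr_cvg0/cvgr0Pnorm_lt => r r0.
have r2 : 0 < r ^+ 2 by rewrite exprn_gt0.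
have := @harmonic_bound_cvg 0 e; move/cvgr0Pnorm_lt/(_ _ r2).
apply: filterS => n; rewrite add0r => hn.
rewrite -(@ltr_pXn2r _ 2) ?nnegrE ?(ltW r0) // real_normK ?num_real //.
by apply: le_lt_trans (h n) _; apply: le_lt_trans (ler_norm _) hn.
Qed.

Lemma cvg_real_sum I (r : seq I) (F : I -> nat -> R) (l : I -> R) :
  (forall i, F i @ \oo --> l i) ->
  (fun n => \sum_(i <- r) F i n) @ \oo --> \sum_(i <- r) l i.
Proof.
move=> Fl; elim: r => [|i r IH].
  by rewrite big_nil; under eq_fun do rewrite big_nil; exact: cvg_cst.
by rewrite big_cons; under eq_fun do rewrite big_cons; exact: cvgD.
Qed.

Lemma hilbert_cvg_unique (u : nat -> H) (l l' : H) :
  u @ \oo --> l -> u @ \oo --> l' -> l = l'.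
Proof. exact: (cvg_unique (@norm_hausdorff _ (rkhs_space H))). Qed.

Lemma cvg_near_const (u : nat -> H) N (l : H) :
  (forall n, (N <= n)%N -> u n = l) -> u @ \oo --> l.
Proof.
move=> h; apply: cvg_near_cst; exists N => // n /= Nn; exact: h.
Qed.

Lemma linD (E : H -> H) u v : linear E -> E (u + v) = E u + E v.
Proof. by move=> l; have := l 1 u v; rewrite !scale1r. Qed.
Lemma lin0 (E : H -> H) : linear E -> E 0 = 0.
Proof.
move=> l; apply: (@addrI _ (E 0)); by rewrite -linD // !addr0.
Qed.
Lemma linZ (E : H -> H) a u : linear E -> E (a *: u) = a *: E u.
Proof. by move=> l; have := l a u 0; rewrite addr0 lin0 // addr0. Qed.
Lemma linB (E : H -> H) u v : linear E -> E (u - v) = E u - E v.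
Proof. by move=> l; rewrite linD // -[- v]scaleN1r linZ // scaleN1r. Qed.
Lemma lin_sum (E : H -> H) I (r : seq I) P (F : I -> H) : linear E ->
  E (\sum_(i <- r | P i) F i) = \sum_(i <- r | P i) E (F i).
Proof.
move=> l; elim/big_rec2: _ => [|i y1 y2 _ <-]; first exact: lin0.
by rewrite linD.
Qed.

Lemma proj_sqn (E : H -> H) v : orthogonal_projection E ->
  sqn (E v) = complex.Re '[E v, v].
Proof. by move=> [_ idem sa]; rewrite /sqn -sa idem. Qed.

Lemma proj_contraction (E : H -> H) v : orthogonal_projection E ->
  sqn (E v) <= sqn v.
Proof.
move=> Ep; have [->|E0] := eqVneq (E v) 0; first by rewrite sqn0 sqn_ge0.
rewrite -(ler_pM2l (sqn_gt0 E0)); apply: le_trans (re_ip_le _ _).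
by rewrite -proj_sqn // expr2.
Qed.

Lemma proj_cvg (E : H -> H) (u : nat -> H) l : orthogonal_projection E ->
  u @ \oo --> l -> (E (u n)) @[n --> \oo] --> E l.
Proof.
move=> Ep /cvg_sqnP ul; apply/cvg_sqnP.
have [El _ _] := Ep.
by apply: squeeze0 ul => n; rewrite sqn_ge0 /= -linB // proj_contraction.
Qed.

Section one_resolution.
Context (A : H -> H) (lam : nat -> R) (E : nat -> H -> H).
Hypothesis res : spectral_resolution A lam E.

Lemma res_proj n : orthogonal_projection (E n). Proof. by case: res. Qed.
Lemma res_lin n : linear (E n). Proof. by have [] := res_proj n. Qed.
Lemma res_orth m n u v : m <> n -> '[E m u, E n v] = 0.
Proof.
move=> mn; have [_ _ sa] := res_proj m; case: res => _ o _ _.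
by rewrite sa o // ip0r.
Qed.

Lemma res_sqn_sum M v :
  sqn (\sum_(0 <= n < M) E n v) = \sum_(0 <= n < M) sqn (E n v).
Proof.
rewrite !big_mkord /sqn ip_suml Re_sum.
apply: eq_bigr => i _; rewrite ip_sumr (bigD1 i) //= big1 ?addr0 // => j ji.
by rewrite res_orth // => ij; move: ji; rewrite -(inj_eq val_inj) /= ij eqxx.
Qed.

Lemma parseval v : series (fun n => sqn (E n v)) @ \oo --> sqn v.
Proof.
have -> : series (fun n => sqn (E n v)) =
    (fun M => sqn (series (fun n => E n v) M)).
  by apply/funext => M; rewrite /series /= res_sqn_sum.
by apply: cvg_sqn; case: res.
Qed.

Lemma parseval_le M v : \sum_(0 <= n < M) sqn (E n v) <= sqn v.
Proof.
have c := @parseval v; rewrite -(cvg_lim (@norm_hausdorff _ _) c); apply: nondecreasing_cvgn_le.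
  by apply: nondecreasing_series => n _ _; exact: sqn_ge0.
by apply/cvg_ex; exists (sqn v).
Qed.

(** Reduces a norm bound to finitely many spectral components, over which sums
    can be exchanged. *)
Lemma parseval_bound v c :
  (forall M, \sum_(0 <= n < M) sqn (E n v) <= c) -> sqn v <= c.
Proof.
by move=> h; apply: (cvg_le_cst (@parseval v)) => M; exact: h. Qed.

Lemma res_apply_proj n v : A (E n v) = (lam n)%:C *: E n v.
Proof.
case: (res) => _ o _ /(_ (E n v)) c; apply: hilbert_cvg_unique c _.
apply: (@cvg_near_const _ n.+1) => M nM; rewrite /series /=.
rewrite big_mkord (bigD1 (Ordinal nM)) //= big1 ?addr0.
  by have [_ -> _] := res_proj n.
move=> j jn; rewrite o ?scaler0 // => jE; move: jn.
by rewrite -(inj_eq val_inj) /= jE eqxx.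
Qed.

Lemma res_proj_apply n v : E n (A v) = (lam n)%:C *: E n v.
Proof.
case: (res) => _ o _ /(_ v) /(proj_cvg (res_proj n)) c.
apply: hilbert_cvg_unique c _.
apply: (@cvg_near_const _ n.+1) => M nM; rewrite /series /= lin_sum; last exact: res_lin.
rewrite big_mkord (bigD1 (Ordinal nM)) //= big1 ?addr0.
  by rewrite linZ; [have [_ -> _] := res_proj n|exact: res_lin].
move=> j jn; rewrite linZ; last exact: res_lin.
rewrite o ?scaler0 // => jE; move: jn.
by rewrite -(inj_eq val_inj) /= jE eqxx.
Qed.

Lemma res_ext u v : (forall n, E n u = E n v) -> u = v.
Proof.
move=> h; case: (res) => _ _ c _; apply: hilbert_cvg_unique (c u) _.
suff -> : (fun n => E n u) = (fun n => E n v) by exact: c.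
by apply/funext => n.
Qed.

End one_resolution.

(** [E_n F_m v] is nonzero only when the two eigenvalues agree, by computing
    [E_n A F_m v] in both orders. *)
Lemma cross_block (A : H -> H) lam E mu F (G : R -> R) n m v :
  spectral_resolution A lam E -> spectral_resolution A mu F ->
  (G (mu m))%:C *: E n (F m v) = (G (lam n))%:C *: E n (F m v).
Proof.
move=> rE rF; have [->//|nm] := eqVneq (mu m) (lam n).
suff -> : E n (F m v) = 0 by rewrite !scaler0.
have := res_proj_apply rE n (F m v); rewrite (res_apply_proj rF).
rewrite linZ; last exact: (res_lin rE).
move/eqP; rewrite -subr_eq0 -scalerBl -rmorphB scaler_eq0 => /orP[|/eqP//].
by rewrite eq_complex /= eqxx andbT subr_eq0 (negPf nm).
Qed.

(** The components of a value of the calculus along any resolution are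
    determined, whichever resolution served to compute it. *)
Lemma calculus_limit_proj (A : H -> H) lam E mu F (G : R -> R) n v g :
  spectral_resolution A lam E -> spectral_resolution A mu F ->
  series (fun m => (G (mu m))%:C *: F m v) @ \oo --> g ->
  E n g = (G (lam n))%:C *: E n v.
Proof.
move=> rE rF /(proj_cvg (res_proj rE n)) c.
apply: hilbert_cvg_unique c _.
have [_ _ /(_ v) /(proj_cvg (res_proj rE n)) cF _] := rF.
have -> : (fun M => E n (series (fun m => (G (mu m))%:C *: F m v) M)) =
  (fun M => (G (lam n))%:C *: E n (series (fun m => F m v) M)).
  apply/funext => M; rewrite /series /= !(lin_sum _ _ _ (res_lin rE n)).
  rewrite scaler_sumr; apply: eq_bigr => m _.
  by rewrite linZ ?(cross_block G n m v rE rF) //; exact: (res_lin rE).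
exact: cvgZl_tmp.
Qed.

(** The calculus picks some resolution; by the previous lemma, any other one
    gives the same vector. *)
Lemma spectral_calculusE (A : H -> H) lam E (G : R -> R) v g :
  spectral_resolution A lam E ->
  series (fun n => (G (lam n))%:C *: E n v) @ \oo --> g ->
  spectral_calculus G A v = g.
Proof.
move=> rE c; rewrite /spectral_calculus; case: xgetP => [g' -> | /(_ g)]; last first.
  by case; exists lam, E.
move=> [mu [F [rF cF]]]; apply: (res_ext rE) => n.
by rewrite (calculus_limit_proj n rE rF cF) (calculus_limit_proj n rE rE c).
Qed.

End resolution.

(** * Sampling operators and their Hilbert-Schmidt norms *)

Section sampling.
Context (R : realType) (X : Type) (K : X -> X -> R[i]) (H : rkhs K).
Implicit Types (u v w f : H) (a : R[i]).
Local Notation "'[ u , v ]" := (rkhs_inner H u v) : ring_scope.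
Local Notation k_ x := (rkhs_section H x).

Lemma ip_section x y : '[k_ x, k_ y] = K y x.
Proof. by rewrite -rkhs_reproducing rkhs_sectionE. Qed.

(** The Hilbert-Schmidt inner product of the rank-one operators
    [v |-> <v, K_x> K_x] and [v |-> <v, K_y> K_y]. *)
Definition sq_kernel (x y : X) : R := abs2 (K x y).

Lemma sq_kernelE x y : sq_kernel x y = abs2 '[k_ x, k_ y].
Proof. by rewrite /sq_kernel -ip_section ipC abs2C. Qed.

Lemma sq_kernelC x y : sq_kernel x y = sq_kernel y x.
Proof. by rewrite !sq_kernelE ipC abs2C. Qed.

Definition sampling_operator (s : seq (R * X)) v : H :=
  \sum_(p <- s) (p.1%:C * '[v, k_ p.2]) *: k_ p.2.

Lemma sampling_sa s u v :
  '[sampling_operator s u, v] = '[u, sampling_operator s v].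
Proof.
rewrite ip_suml ip_sumr; apply: eq_bigr => p _.
by rewrite ipZl ipZr rmorphM /= conjC_real -ipC; ring.
Qed.

Lemma samplingZ s a v : sampling_operator s (a *: v) = a *: sampling_operator s v.
Proof.
rewrite /sampling_operator scaler_sumr; apply: eq_bigr => p _.
by rewrite ipZl scalerA mulrCA.
Qed.

Lemma sampling_cat (s t : seq (R * X)) (v : H) : sampling_operator (s ++ t) v =
  sampling_operator s v + sampling_operator t v.
Proof. by rewrite /sampling_operator big_cat. Qed.

Lemma sampling_neg (s : seq (R * X)) (v : H) :
  sampling_operator (negw s) v = - sampling_operator s v.
Proof.
rewrite /sampling_operator big_map -sumrN; apply: eq_bigr => p _ /=.
by rewrite rmorphN mulNr scaleNr.
Qed.

(** The right-hand side is the squared Hilbert-Schmidt norm of the operator: on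
    an orthonormal basis [e_l] of the span of the sections, it is the sum of the
    [|S e_l|^2].  As S is self-adjoint with range in this span, [|S f_m|^2] is the
    sum over l of [|<S e_l, f_m>|^2], and summing over m first is the Bessel
    inequality for the vectors [S e_l]. *)
Lemma hs_bessel (s : seq (R * X)) M (f : 'I_M -> H) : orthonormal0 f ->
  \sum_(m < M) sqn (sampling_operator s (f m)) <= quad_form sq_kernel s.
Proof.
move=> fo; pose k i := k_ (tnth (in_tuple s) i).2.
have [e [_ [eo _ _ ek]]] := gram_diagonalization k.
have expand u : sampling_operator s u = \sum_l '[sampling_operator s u, e l] *: e l.
  rewrite {1}/sampling_operator big_tnth.
  transitivity (\sum_i \sum_l
      ((tnth (in_tuple s) i).1%:C * '[u, k i] * '[k i, e l]) *: e l).
    apply: eq_bigr => i _; rewrite -/(k i) {2}ek scaler_sumr.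
    by apply: eq_bigr => l _; rewrite scalerA.
  rewrite exchange_big /=; apply: eq_bigr => l _.
  rewrite /sampling_operator [in RHS]big_tnth ip_suml scaler_suml.
  by apply: eq_bigr => i _; rewrite ipZl.
have sqnE u : sqn (sampling_operator s u)
    = \sum_l abs2 '[sampling_operator s (e l), u].
  apply: complexI; rewrite -ip_self {1}expand ip_suml rmorph_sum.
  apply: eq_bigr => l _ /=.
  by rewrite ipZl abs2_conj [in RHS]sampling_sa -ipC sampling_sa mulrC.
under eq_bigr do rewrite sqnE.
rewrite exchange_big /=.
have -> : quad_form sq_kernel s = \sum_l sqn (sampling_operator s (e l)).
  apply: complexI; rewrite !rmorph_sum /=.
  transitivity (\sum_(p <- s) \sum_(q <- s) (p.1%:C * q.1%:C * '[k_ p.2, k_ q.2])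
                  * \sum_l '[k_ q.2, e l] * '[e l, k_ p.2]).
    apply: eq_bigr => p _; rewrite rmorph_sum [LHS]big_tnth [RHS]big_tnth.
    apply: eq_bigr => j _ /=; rewrite -/(k j); set q := tnth _ j.
    have -> : \sum_l '[k j, e l] * '[e l, k_ p.2] = '[k j, k_ p.2].
      rewrite [in RHS](ek j) ip_suml.
      by apply: eq_bigr => l _; rewrite ipZl.
    rewrite rmorphM rmorphM /= sq_kernelE abs2_conj -ipC /k -/q; ring.
  transitivity (\sum_(p <- s) \sum_l \sum_(q <- s)
      (p.1%:C * q.1%:C * '[k_ p.2, k_ q.2])
        * ('[k_ q.2, e l] * '[e l, k_ p.2])).
    apply: eq_bigr => p _; rewrite exchange_big; apply: eq_bigr => q _ /=.
    by rewrite mulr_sumr.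
  rewrite exchange_big /=; apply: eq_bigr => l _.
  rewrite -ip_self [X in '[X, _]]/sampling_operator ip_suml; apply: eq_bigr => p _.
  rewrite ipZl ip_sumr mulr_sumr; apply: eq_bigr => q _.
  by rewrite ipZr rmorphM /= conjC_real -ipC; ring.
apply: ler_sum => l _; apply: bessel; [by case: fo | exact: orthonormal0_le1].
Qed.

(** A squared Hilbert-Schmidt norm is nonnegative: compare with an empty
    family. *)
Lemma sq_kernel_psd (s : seq (R * X)) : 0 <= quad_form sq_kernel s.
Proof.
have fo : orthonormal0 (fun _ : 'I_0 => (0 : H)) by split=> -[].
by have := hs_bessel s fo; rewrite big_ord0.
Qed.

(** The operator norm is at most the Hilbert-Schmidt norm: take a family with
    one vector. *)
Lemma hs_sampling (s : seq (R * X)) v :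
  sqn (sampling_operator s v) <= sqn v * quad_form sq_kernel s.
Proof.
have fo : orthonormal0 (fun _ : 'I_1 => unit_vec v).
  by split=> [i j|_]; rewrite ?ord1 ?eqxx // sqn_unit_vec.
have := hs_bessel s fo; rewrite big_ord1 /=.
have -> : sqn (sampling_operator s v)
    = sqn v * sqn (sampling_operator s (unit_vec v)).
  by rewrite {1}(unit_vecE v) samplingZ sqnZ abs2_real sqr_sqrtr ?sqn_ge0.
by move=> h; rewrite ler_wpM2l ?sqn_ge0.
Qed.

End sampling.

(** * Spectral resolutions of empirical operators *)

Section empirical.
Context (R : realType) (X : Type) (K : X -> X -> R[i]) (H : rkhs K).

Definition empirical (a : R) N (x : 'I_N -> X) : seq (R * X) :=
  [seq (a, x i) | i <- enum 'I_N].

Lemma empirical_sampling N (x : 'I_N -> X) (v : H) :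
  empirical_operator x v = sampling_operator (empirical N%:R^-1 x) v.
Proof.
rewrite /empirical_operator scaler_sumr /sampling_operator big_map big_enum.
by apply: eq_bigr => i _; rewrite scalerA rkhs_reproducing fmorphV rmorph_nat.
Qed.

Lemma mass_empirical n (z : 'I_n.+1 -> X) : mass (empirical (n.+1%:R^-1 : R) z) = 1.
Proof.
have -> : empirical (n.+1%:R^-1 : R) z =
    [seq (n.+1%:R^-1, y) | y <- [seq z i | i <- enum 'I_n.+1]] by rewrite -map_comp.
by rewrite mass_const size_map size_enum_ord mulVf // pnatr_eq0.
Qed.

Lemma empirical_diff_quad_form (phi0 : X -> X -> R) (a : R) N (p q : 'I_N -> X) :
  (forall x y, phi0 x y = phi0 y x) ->
  quad_form phi0 (empirical a p ++ negw (empirical a q)) =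
  a ^+ 2 * \sum_i \sum_j (phi0 (p i) (p j) + phi0 (q i) (q j) - 2 * phi0 (p i) (q j)).
Proof.
move=> phiC; rewrite quad_form_cat // quad_form_neg bilin_form_neg.
have E (F : R * X -> R) (z : 'I_N -> X) :
    \sum_(r <- empirical a z) F r = \sum_i F (a, z i).
  by rewrite big_map big_enum.
rewrite /quad_form /bilin_form !E mulrN -mulNr mulr_sumr -!big_split mulr_sumr.
apply: eq_bigr => i _ /=; rewrite !E mulr_sumr -!big_split mulr_sumr.
by apply: eq_bigr => j _ /=; ring.
Qed.

End empirical.

Section finite_resolution.
Context (R : realType) (X : Type) (K : X -> X -> R[i]) (H : rkhs K).
Implicit Types (u v w f : H) (a : R[i]).
Local Notation "'[ u , v ]" := (rkhs_inner H u v) : ring_scope.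

Section construction.
Context (n : nat) (e : 'I_n -> H) (d : 'I_n -> R).
Hypothesis eo : orthonormal0 e.

Definition span_proj v := \sum_i '[v, e i] *: e i.

(** The resolution of an operator diagonal on [e]: the lines of the [e i], then
    at index [n] the orthogonal complement of their span, then zeros. *)
Definition block_proj (k : nat) v : H :=
  if insub k is Some i then '[v, e i] *: e i
  else if k == n then v - span_proj v else 0.

(** The value 0 at a vanishing [e i] keeps every value inside the bounds
    of the spectrum. *)
Definition block_eig (k : nat) : R :=
  if insub k is Some i then (if e i == 0 then 0 else d i) else 0.

Lemma block_projE (i : 'I_n) v : block_proj i v = '[v, e i] *: e i.
Proof. by rewrite /block_proj valK. Qed.

Lemma block_proj_last v : block_proj n v = v - span_proj v.
Proof. by rewrite /block_proj insubF ?ltnn // eqxx. Qed.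

Lemma block_proj_out k v : (n < k)%N -> block_proj k v = 0.
Proof.
move=> nk; rewrite /block_proj insubF ?gtn_eqF //.
by apply/negbTE; rewrite -leqNgt ltnW.
Qed.

Lemma e_self i : '[e i, e i] *: e i = e i.
Proof.
rewrite ip_self; case: eo => _ ->.
by have [->|_] := eqVneq (e i) 0; rewrite ?scaler0 ?scale1r.
Qed.

Lemma span_proj_e i : span_proj (e i) = e i.
Proof.
rewrite /span_proj (bigD1 i) //= e_self big1 ?addr0 // => j ji.
by case: eo => o _; rewrite o ?scale0r // eq_sym.
Qed.

Lemma span_proj_lin : linear span_proj.
Proof.
move=> a u v; rewrite /span_proj scaler_sumr -big_split; apply: eq_bigr => i _ /=.
by rewrite ipDl ipZl scalerDl scalerA.
Qed.

Lemma block_sum M v : (n < M)%N -> \sum_(0 <= k < M) block_proj k v = v.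
Proof.
move=> nM; rewrite (@big_cat_nat _ _ _ n.+1) //= [X in _ + X]big1_seq ?addr0.
  rewrite big_nat_recr //= block_proj_last big_mkord.
  under eq_bigr do rewrite block_projE.
  by rewrite addrCA subrr addr0.
by move=> k /andP[_]; rewrite mem_index_iota => /andP[nk _]; exact: block_proj_out.
Qed.

Lemma block_ip_e (k : nat) (i : 'I_n) v : k <> i -> '[block_proj k v, e i] = 0.
Proof.
move=> ki; rewrite /block_proj; case: insubP => [j _ jk|_].
  rewrite ipZl; case: eo => -> //; rewrite ?mulr0 //.
  by apply/eqP => ji; apply: ki; rewrite -jk ji.
case: eqP => _; last by rewrite ip0l.
rewrite ipBl {1}/span_proj ip_suml (bigD1 i) //= big1 ?addr0.
  by rewrite ipZl -{2}(e_self i) ipZr -ipC mulrC; case: eo => _ ei; rewrite ip_self ei;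
  have [->|_] := eqVneq (e i) 0; rewrite ?ip0r ?mulr0 ?mul1r subrr.
by move=> j ji; rewrite ipZl; case: eo => -> //; rewrite mulr0.
Qed.

Lemma block_proj_orthogonal k : orthogonal_projection (block_proj k).
Proof.
have sp_sa u v : '[span_proj u, v] = '[u, span_proj v].
  rewrite ip_suml ip_sumr; apply: eq_bigr => i _.
  by rewrite ipZl ipZr -ipC mulrC.
rewrite /block_proj; case: insubP => [i _ ik|_]; last first.
  case: eqP => _; last first.
    split=> [a u v|//|u v]; first by rewrite scaler0 addr0.
    by rewrite ip0l ip0r.
  split=> [a u v|u|u v].
  - by rewrite span_proj_lin scalerBr opprD addrACA.
  - rewrite (linB _ _ span_proj_lin).
    suff -> : span_proj (span_proj u) = span_proj u by rewrite subrr subr0.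
    rewrite {2}/span_proj (lin_sum _ _ _ span_proj_lin); apply: eq_bigr => i _.
    by rewrite (linZ _ _ span_proj_lin) span_proj_e.
  - by rewrite ipBl ipBr sp_sa.
split=> [a u v|u|u v].
- by rewrite ipDl ipZl scalerDl scalerA.
- by rewrite ipZl -scalerA e_self.
- by rewrite ipZl ipZr -ipC mulrC.
Qed.

Lemma block_orth k l v : k <> l -> block_proj k (block_proj l v) = 0.
Proof.
move=> kl; rewrite {1}/block_proj; case: insubP => [i _ ik|kn].
  by rewrite block_ip_e ?scale0r // ik => lk; apply: kl.
case: eqP => // kE.
have [ln|ln|ln] := ltngtP l n; last by case: kl; rewrite kE.
- have := block_projE (Ordinal ln) v => /= ->.
  by rewrite (linZ _ _ span_proj_lin) span_proj_e subrr.
- by rewrite block_proj_out // (lin0 span_proj_lin) subrr.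
Qed.

Lemma block_resolution (A : H -> H) :
  (forall v, A v = \sum_j ((d j)%:C * '[v, e j]) *: e j) ->
  spectral_resolution A block_eig block_proj.
Proof.
move=> AE; split.
- exact: block_proj_orthogonal.
- by move=> k l v; exact: block_orth.
- by move=> v; apply: (@cvg_near_const _ _ _ _ _ n.+1) => M nM; rewrite /series /= block_sum.
- move=> v; apply: (@cvg_near_const _ _ _ _ _ n.+1) => M nM; rewrite /series /=.
  rewrite (@big_cat_nat _ _ _ n.+1) //= [X in _ + X]big1_seq ?addr0.
    rewrite big_nat_recr //= {2}/block_eig insubF ?ltnn // scale0r addr0 AE big_mkord.
    apply: eq_bigr => i _; rewrite block_projE /block_eig valK scalerA.
    by have [->|//] := eqVneq (e i) 0; rewrite !scaler0.
  move=> k /andP[_]; rewrite mem_index_iota => /andP[nk _].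
  by rewrite block_proj_out // scaler0.
Qed.

End construction.
End finite_resolution.

(** * The reconstruction as a function of the empirical operator *)

Section reconstruction.
Context (R : realType) (X : Type) (K : X -> X -> R[i]) (H : rkhs K).
Implicit Types (u v w f : H) (a : R[i]).
Local Notation "'[ u , v ]" := (rkhs_inner H u v) : ring_scope.
Local Notation k_ x := (rkhs_section H x).

Lemma sqn_section (B : R) x : K x x <= B%:C -> sqn (k_ x) <= B.
Proof. by rewrite /sqn ip_section lecE /= => /andP[]. Qed.

(** An eigenvalue is the mean of the [|<e_i, K_(x_l)>|^2] for a unit vector
    [e_i], hence at most [sup K(x, x)]. *)
Lemma empirical_resolution N (x : 'I_N -> X) (B : R) : 0 <= B ->
  (forall i, K (x i) (x i) <= B%:C) ->
  exists lam E, [/\ spectral_resolution (@empirical_operator _ _ _ H _ x) lam E,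
    forall n, 0 <= lam n <= B & forall n v, (N < n)%N -> E n v = 0].
Proof.
move=> B0 KB.
have [e [d [eo d0 Sd _]]] := gram_diagonalization (fun i => k_ (x i)).
have AE v : empirical_operator x v
    = \sum_j ((d j / N%:R)%:C * '[v, e j]) *: e j.
  rewrite /empirical_operator; under eq_bigr do rewrite rkhs_reproducing.
  rewrite Sd scaler_sumr; apply: eq_bigr => j _.
  by rewrite scalerA rmorphM fmorphV rmorph_nat /= mulrCA mulrA.
exists (block_eig e (fun j => d j / N%:R)), (block_proj e); split.
- exact: block_resolution.
- move=> n; rewrite /block_eig; case: insubP => [i iN ik|_]; last by rewrite lexx.
  have [_|ei0] := eqVneq (e i) 0; first by rewrite lexx.
  have N0 : (0 : R) < N%:R by rewrite ltr0n (leq_ltn_trans _ iN).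
  rewrite divr_ge0 ?ler0n //= ler_pdivrMr // .
  have e1 : sqn (e i) = 1 by case: eo => _ ->; rewrite ei0.
  have -> : d i = \sum_l abs2 '[e i, k_ (x l)].
    apply: complexI; rewrite rmorph_sum /=.
    transitivity (\sum_l '[e i, k_ (x l)] * '[k_ (x l), e i]).
      transitivity '[\sum_l '[e i, k_ (x l)] *: k_ (x l), e i].
        rewrite Sd ip_suml (bigD1 i) //= big1 ?addr0.
          by rewrite ipZl ip_self e1 !mulr1.
        by move=> j ji; rewrite ipZl; case: eo => o _; rewrite (o j i ji) mulr0.
      by rewrite ip_suml; apply: eq_bigr => l _; rewrite ipZl.
    by apply: eq_bigr => l _; rewrite abs2_conj -ipC.
  rewrite mulr_natr -[X in _ *+ X](card_ord N) -sumr_const.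
  apply: ler_sum => l _; apply: le_trans (cauchy_schwarz _ _) _.
  by rewrite e1 mul1r; exact: sqn_section.
- by move=> n v; exact: block_proj_out.
Qed.

(** The reason for taking square roots of increments as filters. *)
Lemma filter_telescope (g : nat -> R -> R) l J :
  (forall j l, 0 <= l -> 0 <= g j l <= g j.+1 l) -> 0 <= l ->
  \sum_(0 <= j < J.+1) filter_fun g j l ^+ 2 = g J l.
Proof.
move=> gm l0; elim: J => [|J IH].
  by rewrite big_nat1 /= sqr_sqrtr //; case/andP: (gm 0%N l l0).
rewrite big_nat_recr //= IH sqr_sqrtr ?subr_ge0; last by case/andP: (gm J l l0).
by rewrite addrC subrK.
Qed.

Section finite_calculus.
Context (A : H -> H) (N : nat) (lam : nat -> R) (E : nat -> H -> H).
Hypothesis res : spectral_resolution A lam E.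
Hypothesis fin : forall n v, (N < n)%N -> E n v = 0.

Lemma finite_resolution_sum v : v = \sum_(0 <= n < N.+1) E n v.
Proof.
case: (res) => _ _ /(_ v) c _; apply: hilbert_cvg_unique c _.
apply: (@cvg_near_const _ _ _ _ _ N.+1) => M NM; rewrite /series /=.
rewrite (@big_cat_nat _ _ _ N.+1) //= [X in _ + X]big1_seq ?addr0 // => n.
by rewrite mem_index_iota => /andP[_ /andP[Nn _]]; exact: fin.
Qed.

Lemma proj_finite_calculus (G : R -> R) n v :
  E n (spectral_calculus G A v) = (G (lam n))%:C *: E n v.
Proof.
have c : series (fun m => (G (lam m))%:C *: E m v) @ \oo -->
    series (fun m => (G (lam m))%:C *: E m v) N.+1.
  apply: (@cvg_near_const _ _ _ _ _ N.+1) => M NM; rewrite /series /=.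
  rewrite (@big_cat_nat _ _ _ N.+1) //= [X in _ + X]big1_seq ?addr0 // => m.
  by rewrite mem_index_iota => /andP[_ /andP[Nm _]]; rewrite fin // scaler0.
by rewrite (spectral_calculusE res c) (calculus_limit_proj n res res c).
Qed.

Lemma finite_calculus_sa (G : R -> R) u v :
  '[u, spectral_calculus G A v] = '[spectral_calculus G A u, v].
Proof.
transitivity (\sum_(0 <= n < N.+1) (G (lam n))%:C * '[E n u, v]).
  rewrite [X in '[_, X]]finite_resolution_sum ip_sumr; apply: eq_bigr => n _.
  rewrite proj_finite_calculus ipZr conjC_real; congr (_ * _).
  by have [_ _ ->] := res_proj res n.
rewrite [X in _ = '[X, _]]finite_resolution_sum ip_suml; apply: eq_bigr => n _.
by rewrite proj_finite_calculus ipZl.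
Qed.

End finite_calculus.

(** The j-th layer is [G_j(That) That G_j(That) f], because [G_j(That)] is
    self-adjoint and the wavelets are the images of the sections whose rank-one
    operators make up [That].  On an eigenspace the layers add up to
    [l * sum_j G_j(l)^2 = l * g_J(l)]. *)
Lemma proj_reconstruction N (x : 'I_N -> X) lam E (g : nat -> R -> R) (tau : R) f n :
  spectral_resolution (@empirical_operator _ _ _ H _ x) lam E ->
  (forall n v, (N < n)%N -> E n v = 0) ->
  (forall j l, 0 <= l -> 0 <= g j l <= g j.+1 l) -> 0 <= lam n ->
  E n (mc_reconstruction g x tau f) =
  (lam n * g (Num.truncn tau) (lam n))%:C *: E n f.
Proof.
move=> res fin gm l0; rewrite /mc_reconstruction (lin_sum _ _ _ (res_lin res n)).
rewrite -(filter_telescope _ gm l0) mulr_sumr rmorph_sum scaler_suml.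
apply: eq_bigr => j _ /=; set G := filter_fun g j.
set T := @empirical_operator _ _ _ H _ x.
have := res_proj_apply res n (spectral_calculus G T f).
rewrite (proj_finite_calculus res fin) scalerA {1}/T /empirical_operator.
rewrite !(linZ _ _ (res_lin res n)) !(lin_sum _ _ _ (res_lin res n)) => h.
have -> : lam n * G (lam n) ^+ 2 = G (lam n) * (lam n * G (lam n)) by ring.
rewrite rmorphM -[RHS]scalerA; move: h; rewrite -rmorphM => <-.
rewrite scalerA [in RHS]mulrC -scalerA; congr (_ *: _).
rewrite scaler_sumr; apply: eq_bigr => i _.
rewrite ?(linZ _ _ (res_lin res n)) /mc_wavelet (proj_finite_calculus res fin).
by rewrite (finite_calculus_sa res fin) rkhs_reproducing !scalerA mulrC.
Qed.

End reconstruction.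

(** * Stability and bias of the spectral calculus *)

Section stability.
Context (R : realType) (X : Type) (K : X -> X -> R[i]) (H : rkhs K).
Implicit Types (u v w f : H) (a : R[i]).
Local Notation "'[ u , v ]" := (rkhs_inner H u v) : ring_scope.

Lemma sqn_sum n (v : 'I_n -> H) :
  sqn (\sum_i v i) = \sum_i \sum_j complex.Re '[v i, v j].
Proof.
rewrite /sqn ip_suml Re_sum; apply: eq_bigr => i _.
by rewrite ip_sumr Re_sum.
Qed.

Lemma sqn_wsum_le n (c : 'I_n -> R) (v : 'I_n -> H) :
  sqn (\sum_i (c i)%:C *: v i) <= (\sum_i c i ^+ 2) * \sum_i sqn (v i).
Proof.
rewrite sqn_sum -(ler_pM2l (ltr0n R 2)).
have -> : 2 * ((\sum_i c i ^+ 2) * \sum_i sqn (v i)) =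
   \sum_i \sum_j (c i ^+ 2 * sqn (v j) + c j ^+ 2 * sqn (v i)).
  symmetry; transitivity (\sum_i (c i ^+ 2 * (\sum_j sqn (v j))
                                + (\sum_j c j ^+ 2) * sqn (v i))).
    by apply: eq_bigr => i _; rewrite big_split /= -mulr_sumr -mulr_suml.
  rewrite big_split /= -mulr_suml -mulr_sumr; ring.
rewrite mulr_sumr; apply: ler_sum => i _.
rewrite mulr_sumr; apply: ler_sum => j _.
have := sqn_ge0 ((c j)%:C *: v i - (c i)%:C *: v j).
rewrite sqnD sqnN !sqnZ !abs2_real -scaleNr !ipZl !ipZr rmorphN /= conjC_real.
by rewrite conjC_real; case: '[v i, v j] => a b /=; lra.
Qed.

Section two_operators.
Context (A B : H -> H) (lam mu : nat -> R) (E F : nat -> H -> H) (N : nat).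
Hypotheses (resA : spectral_resolution A lam E) (resB : spectral_resolution B mu F).
Hypothesis finB : forall n v, (N < n)%N -> F n v = 0.
Context (phi : R -> R) (b L S : R).
Hypothesis lamb : forall n v, E n v != 0 -> 0 <= lam n <= b.
Hypothesis mub : forall n, 0 <= mu n <= b.
Hypothesis phiL : forall l m : R, 0 <= l <= b -> 0 <= m <= b ->
  (phi l - phi m) ^+ 2 <= L ^+ 2 * (l - m) ^+ 2.
Hypothesis hs : forall M (f : 'I_M -> H), orthonormal0 f ->
  \sum_m sqn (A (f m) - B (f m)) <= S.

(** With [f = sum_m s_m e_m] for unit vectors [e_m] of the ranges of the [F m],
    the n-th component of [phi(A) f - phi(B) f] is the sum of the
    [s_m (phi(lam_n) - phi(mu_m)) E_n e_m].  The Lipschitz bound replaces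
    [phi(lam_n) - phi(mu_m)] by [L (lam_n - mu_m)], and
    [(lam_n - mu_m) E_n e_m] is [E_n (A e_m - B e_m)]; the Cauchy-Schwarz
    inequality over m then leaves a Hilbert-Schmidt sum. *)
Lemma calculus_stability f r M :
  (forall n, F n r = (phi (mu n))%:C *: F n f) ->
  \sum_(0 <= n < M) sqn ((phi (lam n))%:C *: E n f - E n r)
  <= L ^+ 2 * S * sqn f.
Proof.
move=> Fr.
pose e (m : 'I_N.+1) := unit_vec (F m f).
pose s (m : 'I_N.+1) := Num.sqrt (sqn (F m f)).
have Fe (m : 'I_N.+1) : F m f = (s m)%:C *: e m by exact: unit_vecE.
have eo : orthonormal0 e.
  apply: (@orthonormal0_unit _ _ _ _ _ (fun m : 'I_N.+1 => F m f)) => i j ij.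
  by apply: (res_orth resB) => /val_inj ijE; move: ij; rewrite ijE eqxx.
have Be m : B (e m) = (mu m)%:C *: e m.
  rewrite /e /unit_vec -(linZ _ _ (res_lin resB m)).
  exact: (res_apply_proj resB).
have ss : \sum_m s m ^+ 2 = sqn f.
  rewrite [in RHS](finite_resolution_sum resB finB f) (res_sqn_sum resB) big_mkord.
  by apply: eq_bigr => m _; rewrite sqr_sqrtr ?sqn_ge0.
have term n : sqn ((phi (lam n))%:C *: E n f - E n r) <=
    sqn f * \sum_m (L ^+ 2 * sqn (E n (A (e m) - B (e m)))).
  have -> : (phi (lam n))%:C *: E n f - E n r =
      \sum_m (s m)%:C *: ((phi (lam n) - phi (mu m))%:C *: E n (e m)).
    rewrite {1}(finite_resolution_sum resB finB f).
    rewrite (finite_resolution_sum resB finB r) !big_mkord.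
    rewrite !(lin_sum _ _ _ (res_lin resA n)) scaler_sumr -sumrB.
    apply: eq_bigr => m _; rewrite Fr Fe !(linZ _ _ (res_lin resA n)).
    by rewrite !scalerA -scalerBl; congr (_ *: _); rewrite rmorphB /=; ring.
  apply: le_trans (sqn_wsum_le _ _) _; rewrite ss ler_wpM2l ?sqn_ge0 //.
  apply: ler_sum => m _; rewrite Be (linB _ _ (res_lin resA n)).
  rewrite (res_proj_apply resA) (linZ _ _ (res_lin resA n)) -scalerBl -rmorphB.
  rewrite !sqnZ !abs2_real mulrA.
  have [->|e0] := eqVneq (E n (e m)) 0; first by rewrite sqn0 !mulr0.
  by rewrite ler_wpM2r ?sqn_ge0 // phiL //; exact: lamb e0.
apply: le_trans (ler_sum _ (fun n _ => term n)) _.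
rewrite -mulr_sumr exchange_big /= mulrC ler_wpM2r ?sqn_ge0 //.
under eq_bigr do rewrite -mulr_sumr.
rewrite -mulr_sumr ler_wpM2l ?sqr_ge0 //; apply: le_trans (hs eo).
by apply: ler_sum => m _; exact: (parseval_le resA).
Qed.

End two_operators.

Section source_condition.
Context (A : H -> H) (lam : nat -> R) (E : nat -> H -> H).
Hypothesis resA : spectral_resolution A lam E.
Context (phi psi : R -> R) (a b c : R) (f h r : H).
Hypothesis lamb : forall n v, E n v != 0 -> 0 <= lam n <= b.
Hypothesis src : series (fun n => (psi (lam n))%:C *: E n h) @ \oo --> f.

Lemma source_proj n : E n f = (psi (lam n))%:C *: E n h.
Proof. exact: (calculus_limit_proj n resA resA src). Qed.

Lemma source_norm :
  (forall l : R, 0 <= l <= b -> psi l ^+ 2 <= c) -> 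
  sqn f <= c * sqn h.
Proof.
move=> psic; apply: (parseval_bound resA) => M.
have [c0|c0] := leP 0 c.
  apply: le_trans (_ : \sum_(0 <= n < M) c * sqn (E n h) <= _); last first.
    by rewrite -mulr_sumr ler_wpM2l // (parseval_le resA).
  apply: ler_sum => n _; rewrite source_proj sqnZ abs2_real.
  have [->|e0] := eqVneq (E n h) 0; first by rewrite sqn0 !mulr0.
  by rewrite ler_wpM2r ?sqn_ge0 // psic //; exact: lamb e0.
(* A negative c leaves no point in the spectrum, so the space is trivial. *)
have E0 n v : E n v = 0.
  apply/eqP; apply: contraTT c0 => /lamb lb; rewrite -leNgt.
  by apply: le_trans (psic _ lb); exact: sqr_ge0.
have h0 : sqn h = 0.
  have -> : h = 0 by apply: (res_ext resA) => n; rewrite !E0.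
  exact: sqn0.
by rewrite h0 mulr0 big1 // => n _; rewrite E0 sqn0.
Qed.

(** The bias acts diagonally on the components of [h], so only its supremum
    over the spectrum matters. *)
Lemma error_split S :
  (forall l : R, 0 <= l <= b -> ((1 - phi l) * psi l) ^+ 2 <= a ^+ 2) ->
  (forall M, \sum_(0 <= n < M) sqn ((phi (lam n))%:C *: E n f - E n r) <= S) ->
  sqn (f - r) <= 2 * a ^+ 2 * sqn h + 2 * S.
Proof.
move=> bias stab; apply: (parseval_bound resA) => M.
apply: le_trans (_ : \sum_(0 <= n < M) (2 * a ^+ 2 * sqn (E n h) +
   2 * sqn ((phi (lam n))%:C *: E n f - E n r)) <= _); last first.
  rewrite big_split /= -!mulr_sumr lerD // ler_wpM2l //.
    by rewrite mulr_ge0 ?sqr_ge0.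
  exact: (parseval_le resA).
apply: ler_sum => n _; rewrite (linB _ _ (res_lin resA n)).
have -> : E n f - E n r = (1 - phi (lam n))%:C *: E n f
   + ((phi (lam n))%:C *: E n f - E n r).
  by rewrite addrA -scalerDl -rmorphD subrK scale1r.
apply: le_trans (sqnD_le2 _ _) _; rewrite lerD2r -mulrA ler_wpM2l //.
rewrite {1}source_proj scalerA -rmorphM sqnZ abs2_real.
have [->|e0] := eqVneq (E n h) 0; first by rewrite sqn0 !mulr0.
by rewrite ler_wpM2r ?sqn_ge0 // bias //; exact: lamb e0.
Qed.

End source_condition.
End stability.

(** * Centered kernels and herding *)

Section herding.
Context (R : realType) d (Y : measurableType d) (rho : probability Y R).
Context (phi : Y -> Y -> R).
Hypothesis phiC : forall x y, phi x y = phi y x.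
Hypothesis phib : forall x, bounded_mfun (phi x).

Definition kmean x : R := \int[rho]_y phi x y.

Hypothesis kmeanb : bounded_mfun kmean.

Definition kmean2 : R := \int[rho]_x kmean x.

(** The inner product of the features of [x] and [y] after subtracting their
    mean.  For the kernel [|K|^2] and weights of total mass one, the
    quadratic form of the centered kernel is the squared Hilbert-Schmidt distance
    between the sampling operator and the integral operator. *)
Definition centered x y : R := phi x y - kmean x - kmean y + kmean2.

Lemma centeredC x y : centered x y = centered y x.
Proof. by rewrite /centered phiC; ring. Qed.

Lemma centered_bounded x : bounded_mfun (centered x).
Proof.
have b1 := bounded_mfunZ (-1) kmeanb.
have b2 := bounded_mfun_cst Y (kmean2 - kmean x).
have b3 := bounded_mfunD (phib x) (bounded_mfunD b1 b2).
by move: b3; congr bounded_mfun; apply/funext => y; rewrite /centered; ring.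
Qed.

Lemma mean_centered x : \int[rho]_y centered x y = 0.
Proof.
rewrite /centered.
transitivity (\int[rho]_y (phi x y + ((-1) * kmean y + (kmean2 - kmean x)))).
  by apply: eq_Rintegral => y _; ring.
have b1 := bounded_mfunZ (-1) kmeanb.
have b2 := bounded_mfun_cst Y (kmean2 - kmean x).
rewrite meanD //; last exact: bounded_mfunD.
by rewrite meanD // meanZ // mean_cst -/(kmean x) -/kmean2; ring.
Qed.

Lemma quad_form_centered s : mass s = 0 ->
  quad_form centered s = quad_form phi s.
Proof.
move=> s0; rewrite /quad_form.
transitivity (\sum_(p <- s) (\sum_(q <- s) p.1 * q.1 * phi p.2 q.2
   - p.1 * kmean p.2 * mass s
   + (p.1 * kmean2 * mass s - p.1 * \sum_(q <- s) q.1 * kmean q.2))).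
  apply: eq_bigr => p _; rewrite /mass !mulr_sumr -!sumrB -big_split.
  by apply: eq_bigr => q _ /=; rewrite /centered; ring.
rewrite s0; under eq_bigr do rewrite !mulr0 subr0 sub0r.
by rewrite big_split /= sumrN -mulr_suml -/(mass s) s0 mul0r oppr0 addr0.
Qed.

Context (M : R).
Hypothesis diagM : forall x, centered x x <= M.

(** The cross term between the new point and the old ones has mean zero as a
    function of the new point, so at some point it is nonpositive and only the
    diagonal term is paid. *)
Lemma greedy_step s a : exists z,
  quad_form centered ((a, z) :: s) <= quad_form centered s + a ^+ 2 * M.
Proof.
have gb : bounded_mfun (fun z => a * \sum_(q <- s) q.1 * centered q.2 z).
  by apply/bounded_mfunZ/bounded_mfun_sum => q; exact/bounded_mfunZ/centered_bounded.
have [z gz] : exists z, a * (\sum_(q <- s) q.1 * centered q.2 z) <= 0.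
  apply: (exists_le_mean0 (rho := rho) gb).
  rewrite meanZ ?mean_sum; first last.
  - by apply: bounded_mfun_sum => q; exact/bounded_mfunZ/centered_bounded.
  - by move=> q; exact/bounded_mfunZ/centered_bounded.
  rewrite big1 ?mulr0 // => q _.
  by rewrite meanZ ?mean_centered ?mulr0 //; exact: centered_bounded.
exists z; rewrite quad_form_cons; last exact: centeredC.
have : a ^+ 2 * centered z z <= a ^+ 2 * M by rewrite ler_wpM2l ?sqr_ge0.
lra.
Qed.

Lemma greedy n s a : exists z : seq Y, size z = n /\
  quad_form centered ([seq (a, y) | y <- z] ++ s)
    <= quad_form centered s + n%:R * (a ^+ 2 * M).
Proof.
elim: n => [|n [z [<- IH]]]; first by exists [::]; rewrite mul0r addr0.
have [y hy] := greedy_step ([seq (a, y) | y <- z] ++ s) a.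
exists (y :: z); split=> //=; apply: le_trans hy _.
by rewrite -natr1; nra.
Qed.

(** Greedy points with equal weights pay [n] diagonal terms of size [M / n^2];
    this is the rate of random sampling, reached deterministically. *)
Lemma herding n : (0 < n)%N -> exists z : 'I_n -> Y,
  quad_form centered [seq (n%:R^-1, z i) | i <- enum 'I_n] <= M / n%:R.
Proof.
move=> n0; have [z [sz]] := greedy n [::] n%:R^-1.
rewrite cats0 {2}/quad_form big_nil add0r => h.
pose t : n.-tuple Y := Tuple (introT eqP sz).
exists (tnth t).
have -> : [seq (n%:R^-1, tnth t i) | i <- enum 'I_n] = [seq (n%:R^-1 : R, y) | y <- z].
  by rewrite -[z]/(tval t) -[in RHS](map_tnth_enum t) -map_comp.
apply: le_trans h _; rewrite le_eqVlt; apply/orP; left; apply/eqP.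
have : (n%:R : R) != 0 by rewrite pnatr_eq0 -lt0n.
by move=> ?; field.
Qed.

(** Spreading the mass [- mass s] over many greedy points brings the total mass
    to zero at a cost tending to zero, and on configurations of mass zero
    the centered and the original forms agree. *)
Lemma centered_psd : (forall s, mass s = 0 -> 0 <= quad_form phi s) ->
  forall s, 0 <= quad_form centered s.
Proof.
move=> psd s; rewrite leNgt; apply/negP => q0.
(* Enough points for their cost, (mass s)^2 M / n, to stay below the defect. *)
have [n hn] : exists n : nat, mass s ^+ 2 * `|M| < - quad_form centered s * n.+1%:R.
  pose r := mass s ^+ 2 * `|M| / - quad_form centered s.
  exists (Num.truncn r); rewrite [ltRHS]mulrC -ltr_pdivrMr ?oppr_gt0 //.
  exact: truncnS_gt.
have [z [sz h]] := greedy n.+1 s (- mass s / n.+1%:R).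
set w := (X in quad_form _ X) in h.
have w0 : mass w = 0.
  rewrite mass_cat mass_const sz mulfVK ?addNr // pnatr_eq0 //.
have := psd w w0; rewrite -quad_form_centered // leNgt => /negP; apply.
apply: le_lt_trans h _.
have nn : (n.+1%:R : R) != 0 by rewrite pnatr_eq0.
have -> : n.+1%:R * ((- mass s / n.+1%:R) ^+ 2 * M) = mass s ^+ 2 * M / n.+1%:R.
  by field.
rewrite -ltrBrDl sub0r ltr_pdivrMr ?ltr0n //; apply: le_lt_trans hn.
by rewrite ler_wpM2l ?sqr_ge0 // ler_norm.
Qed.

End herding.

Section mean_error.
Context (R : realType) d (Y : measurableType d) (rho : probability Y R).
Context (W : Y -> Y -> R) (a : Y -> R) (C M : R).
Hypothesis WC : forall x y, W x y = W y x.
Hypothesis Wb : forall x, bounded_mfun (W x).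
Hypothesis kWb : bounded_mfun (kmean rho W).
Hypothesis diagM : forall x, centered rho W x x <= M.
Hypothesis ab : bounded_mfun a.
Hypothesis C0 : 0 <= C.
Hypothesis aW : forall s : seq (R * Y),
  (\sum_(p <- s) p.1 * a p.2) ^+ 2 <= C * quad_form W s.

Let phi x y := C * W x y + (- a x) * a y.

Lemma kmean_rank1 x : kmean rho phi x = C * kmean rho W x + (- a x) * \int[rho]_y a y.
Proof.
rewrite /kmean /phi meanD ?meanZ //; exact: bounded_mfunZ.
Qed.

Lemma centered_rank1 x y : centered rho phi x y =
  C * centered rho W x y - (a x - \int[rho]_y a y) * (a y - \int[rho]_y a y).
Proof.
rewrite /centered /kmean2 !kmean_rank1 /phi.
have -> : \int[rho]_z kmean rho phi z =
    C * (\int[rho]_z kmean rho W z) + (- \int[rho]_z a z) * \int[rho]_y a y.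
  transitivity (\int[rho]_z (C * kmean rho W z + (- (\int[rho]_y a y)) * a z)).
    by apply: eq_Rintegral => z _; rewrite kmean_rank1; ring.
  by rewrite meanD ?meanZ //; exact: bounded_mfunZ.
ring.
Qed.

Lemma quad_form_rank1 phi0 (b : Y -> R) s :
  quad_form (fun x y => C * phi0 x y - b x * b y) s =
  C * quad_form phi0 s - (\sum_(p <- s) p.1 * b p.2) ^+ 2.
Proof.
rewrite /quad_form expr2 mulr_suml mulr_sumr -sumrB; apply: eq_bigr => p _.
rewrite !mulr_sumr -sumrB; apply: eq_bigr => q _; ring.
Qed.

(** The hypothesis on [a] says that the kernel [C W - a a] is positive; then so
    is its centering, which is [C] times the centered [W] minus the product of
    the [a - mean a].  Evaluated at a configuration of mass one, this is
    the claim. *)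
Lemma mean_error_bound s : mass s = 1 ->
  (\sum_(p <- s) p.1 * a p.2 - \int[rho]_y a y) ^+ 2
  <= C * quad_form (centered rho W) s.
Proof.
move=> s1.
have phiC x y : phi x y = phi y x by rewrite /phi WC; ring.
have phib x : bounded_mfun (phi x).
  by apply: bounded_mfunD; exact: bounded_mfunZ.
have kphib : bounded_mfun (kmean rho phi).
  have -> : kmean rho phi = (fun x => C * kmean rho W x + (- \int[rho]_y a y) * a x).
    by apply/funext => x; rewrite kmean_rank1; ring.
  by apply: bounded_mfunD; exact: bounded_mfunZ.
have phi0 t : 0 <= quad_form phi t.
  have -> : quad_form phi t = quad_form (fun x y => C * W x y - a x * a y) t.
    by apply: eq_bigr => p _; apply: eq_bigr => q _; rewrite /phi mulNr.
  by rewrite quad_form_rank1 subr_ge0.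
have diag x : centered rho phi x x <= C * M.
  by rewrite centered_rank1 lerBlDr -[leLHS]addr0 lerD ?ler_wpM2l // -expr2 sqr_ge0.
have := centered_psd phiC phib kphib diag (fun t _ => phi0 t) s.
have -> : quad_form (centered rho phi) s = quad_form (fun x y =>
    C * centered rho W x y - (a x - \int[rho]_z a z) * (a y - \int[rho]_z a z)) s.
  by apply: eq_bigr => p _; apply: eq_bigr => q _; rewrite centered_rank1.
rewrite quad_form_rank1 subr_ge0; apply: le_trans.
rewrite le_eqVlt; apply/orP; left; apply/eqP; congr (_ ^+ 2).
under [RHS]eq_bigr do rewrite mulrBr.
by rewrite sumrB -mulr_suml -/(mass s) s1 mul1r.
Qed.

End mean_error.

(** * Continuity and measurability *)

Section second_countable_measurability.
Context (X : ptopologicalType).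
Hypothesis sc : @second_countable X.

Lemma countable_base : exists b : nat -> set X, (forall k, open (b k)) /\
  forall x U, nbhs x U -> exists k, b k x /\ b k `<=` U.
Proof.
have [B /countable_injP[f finj] [Bo Bx]] := sc.
pose b k := xget set0 [set U | B U /\ f U = k].
have bE U : B U -> b (f U) = U.
  move=> BU; rewrite /b; case: xgetP => [V _ [BV fV]|/(_ U)]; last by case.
  by apply: finj; rewrite ?inE.
exists b; split=> [k|x U].
  rewrite /b; case: xgetP => [V _ [BV _]|_]; first exact: Bo.
  exact: open0.
move=> /(Bx x)[V [BV Vx] VU]; exists (f V); rewrite bE //; split => //.
Qed.

(** Basic boxes inside D cover it, and there are countably many of them. *)
Lemma open_boxes_measurable d (Omega : measurableType d) N
  (x : 'I_N -> Omega -> X) (D : set ('I_N -> X)) :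
  (forall i, measurable_fun setT (x i : Omega -> borel X)) ->
  (forall p, D p -> exists U : 'I_N -> set X, (forall i, nbhs (p i) (U i)) /\
     (forall q, (forall i, U i (q i)) -> D q)) ->
  measurable [set w | D (x ^~ w)].
Proof.
move=> mx Dbox; have [b [bo bx]] := countable_base.
pose F (s : {ffun 'I_N -> nat}) : set Omega :=
  if `[< forall q, (forall i, b (s i) (q i)) -> D q >]
  then \bigcap_(i in [set: 'I_N]) (x i @^-1` b (s i)) else set0.
have -> : [set w | D (x ^~ w)] = \bigcup_s F s.
  apply/seteqP; split=> [w /Dbox[U [Uw UD]]|w [s _]].
    have [s sP] := choice (fun i => bx _ _ (Uw i)).
    exists (finfun s) => //; rewrite /F asboolT.
      by move=> i _ /=; rewrite ffunE; have [] := sP i.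
    move=> q qs; apply: UD => i; have [_] := sP i; apply.
    by have := qs i; rewrite ffunE.
  rewrite /F; case: asboolP => // h sw; apply: h => i; exact: sw.
apply: countable_bigcupT_measurable; first exact: countableP.
move=> s; rewrite /F; case: asboolP => // _.
apply: fin_bigcap_measurable => // i _.
rewrite -[X in measurable X]setTI; apply: mx => //.
exact: sub_sigma_algebra.
Qed.

Context (R : realType).

Lemma continuous_measurable1 (f : X -> R) : continuous f ->
  measurable_fun setT (f : borel X -> R).
Proof.
move=> cf mD; apply: (measurability _ (RGenOInfty.measurableE R)) => //.
move=> /= _ [_ [r ->] <-]; rewrite setTI; apply: sub_sigma_algebra.
by move/continuousP: cf; apply; exact: interval_open.
Qed.

(** The Borel sets of the product are generated by a countable base of boxes, so
    joint continuity gives measurability for the product of the Borel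
    sigma-algebras. *)
Lemma continuous_measurable2 (f : X -> X -> R) :
  continuous (fun p : X * X => f p.1 p.2) ->
  measurable_fun setT (fun p : borel X * borel X => f p.1 p.2).
Proof.
move=> cf mD; apply: (measurability _ (RGenOInfty.measurableE R)) => //.
move=> /= _ [_ [r ->] <-]; rewrite setTI.
pose x (i : 'I_2) (p : borel X * borel X) : X := if i == ord0 then p.1 else p.2.
pose D := [set z : 'I_2 -> X | r < f (z ord0) (z ord_max)].
have -> : (fun p => f p.1 p.2) @^-1` `]r, +oo[ = [set w | D (x ^~ w)].
  by apply/seteqP; split=> w /=; rewrite in_itv /= andbT.
apply: open_boxes_measurable.
  move=> i; rewrite /x; case: eqP => _; [exact: measurable_fst|exact: measurable_snd].
move=> p Dp.
have := cvgr_gt _ (cf (p ord0, p ord_max)) _ Dp.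
move=> [[U V]] /= [nU nV] UV.
exists (fun i : 'I_2 => if i == ord0 then U else V); split.
  by move=> i; case: (eqVneq i ord0) => [->//|]; case: (unliftP ord0 i) => [j ->|->] //;
   rewrite (ord1 j) (_ : lift _ _ = ord_max) //; exact: val_inj.
move=> q qU; apply: (UV (q ord0, q ord_max)); split => /=.
  by have := qU ord0.
by have := qU ord_max.
Qed.

End second_countable_measurability.

Section kernel_regularity.
Context (R : realType) (X : ptopologicalType) (K : X -> X -> R[i]) (H : rkhs K).
Hypothesis cK : continuous_kernel K.
Local Notation k_ x := (rkhs_section H x).

Lemma continuous_Re : continuous (@complex.Re R : R[i]^o -> R).
Proof.
move=> z A /nbhs_ballP[e /= e0 eA].
have e0' : (0 : R[i]) < e%:C by rewrite ltcR.
apply: (@filterS _ _ (@nbhs_filter (R[i]^o) z) _ _ _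
  (nbhsx_ballx (z : R[i]^o) _ e0')) => w /= zw; apply: eA; move: zw.
rewrite /ball /= -ltcR; apply: le_lt_trans.
apply: le_trans (normc_ge_Re (z - w)).
by case: z w => [a b] [c d].
Qed.

Lemma continuous_Im : continuous (@complex.Im R : R[i]^o -> R).
Proof.
move=> z A /nbhs_ballP[e /= e0 eA].
have e0' : (0 : R[i]) < e%:C by rewrite ltcR.
apply: (@filterS _ _ (@nbhs_filter (R[i]^o) z) _ _ _
  (nbhsx_ballx (z : R[i]^o) _ e0')) => w /= zw; apply: eA; move: zw.
rewrite /ball /= -ltcR; apply: le_lt_trans.
rewrite normc_def lecR -sqrtr_sqr; apply: ler_wsqrtr.
by case: z w => [a b] [c d] /=; rewrite lerDr sqr_ge0.
Qed.

Lemma continuous_ReK : continuous (fun p : X * X => complex.Re (K p.1 p.2)).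
Proof.
move=> p; apply: (@continuous_comp _ (R[i]^o) _
  (fun p : X * X => K p.1 p.2 : R[i]^o) (@complex.Re R)); first exact: cK.
exact: continuous_Re.
Qed.

Lemma continuous_ImK : continuous (fun p : X * X => complex.Im (K p.1 p.2)).
Proof.
move=> p; apply: (@continuous_comp _ (R[i]^o) _
  (fun p : X * X => K p.1 p.2 : R[i]^o) (@complex.Im R)); first exact: cK.
exact: continuous_Im.
Qed.

Lemma continuous_sq_kernel :
  continuous (fun p : X * X => sq_kernel K p.1 p.2).
Proof.
move=> p; rewrite /sq_kernel /abs2.
by apply: cvgD; apply: cvgM; (exact: continuous_ReK || exact: continuous_ImK).
Qed.

Lemma continuous_section2 (f : X * X -> R) x : continuous f ->
  continuous (fun y => f (x, y)).
Proof.
move=> cf y; apply: (@continuous_comp _ _ _ (fun y => (x, y)) f); last exact: cf.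
by apply: cvg_pair => //; exact: cvg_cst.
Qed.

Lemma sqn_section_diff x y : sqn (k_ y - k_ x) =
  complex.Re (K y y) - 2 * complex.Re (K x y) + complex.Re (K x x).
Proof.
rewrite sqnD sqnN -scaleN1r ipZr rmorphN rmorph1 mulN1r /sqn !ip_section.
by case: (K x y) => a b /=; lra.
Qed.

(** [|v(y) - v(x)|^2 <= |v|^2 |K_y - K_x|^2], and the feature map is
    continuous. *)
Lemma rkhs_fun_abs2_cvg (v : H) x e : 0 < e ->
  \forall y \near x, abs2 (rkhs_fun v y - rkhs_fun v x) < e.
Proof.
move=> e0.
have : (fun y => sqn v * sqn (k_ y - k_ x)) y @[y --> x] --> (0 : R).
  have -> : 0 = sqn v * (complex.Re (K x x) - 2 * complex.Re (K x x)
     + complex.Re (K x x)) by ring.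
  under eq_fun do rewrite sqn_section_diff.
  apply: cvgMl_tmp; apply: cvgD; last exact: cvg_cst.
  apply: cvgB; last first.
    by apply: cvgMl_tmp; exact: (@continuous_section2 _ x continuous_ReK x).
  apply: (@continuous_comp _ _ _ (fun y : X => (y, y))
    (fun p => complex.Re (K p.1 p.2)) x); last exact: continuous_ReK.
  by apply: cvg_pair; exact: cvg_id.
move=> /cvgrPdist_lt/(_ _ e0); apply: filterS => y.
rewrite sub0r normrN; apply: le_lt_trans; apply: le_trans (ler_norm _).
rewrite !rkhs_reproducing -ipBr; exact: cauchy_schwarz.
Qed.

Lemma continuous_rkhs_Re (v : H) : continuous (fun y => complex.Re (rkhs_fun v y)).
Proof.
move=> x; apply/cvgrPdist_lt => e e0.
have e20 : 0 < e ^+ 2 by rewrite exprn_gt0.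
apply: filterS (rkhs_fun_abs2_cvg v x e20) => y.
move=> h; rewrite -(@ltr_pXn2r _ 2) ?nnegrE ?(ltW e0) // real_normK ?num_real //.
apply: le_lt_trans h; rewrite /abs2; case: (rkhs_fun v y) (rkhs_fun v x) => a b [c d] /=.
by rewrite -(opprB a c) sqrrN lerDl sqr_ge0.
Qed.

Lemma continuous_rkhs_Im (v : H) : continuous (fun y => complex.Im (rkhs_fun v y)).
Proof.
move=> x; apply/cvgrPdist_lt => e e0.
have e20 : 0 < e ^+ 2 by rewrite exprn_gt0.
apply: filterS (rkhs_fun_abs2_cvg v x e20) => y.
move=> h; rewrite -(@ltr_pXn2r _ 2) ?nnegrE ?(ltW e0) // real_normK ?num_real //.
apply: le_lt_trans h; rewrite /abs2; case: (rkhs_fun v y) (rkhs_fun v x) => a b [c d] /=.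
by rewrite -(opprB b d) sqrrN lerDr sqr_ge0.
Qed.

Lemma continuous_integrand x (v : H) :
  continuous (fun y => complex.Re (K x y * rkhs_fun v y)) /\
  continuous (fun y => complex.Im (K x y * rkhs_fun v y)).
Proof.
have cR := @continuous_section2 _ x continuous_ReK.
have cI := @continuous_section2 _ x continuous_ImK.
split=> y.
  have -> : (fun y => complex.Re (K x y * rkhs_fun v y)) = (fun y =>
      complex.Re (K x y) * complex.Re (rkhs_fun v y)
      - complex.Im (K x y) * complex.Im (rkhs_fun v y)).
    by apply/funext => z; case: (K x z) => ? ?; case: (rkhs_fun v z).
  apply: cvgB; apply: cvgM; [exact: cR|exact: continuous_rkhs_Re|
    exact: cI|exact: continuous_rkhs_Im].
have -> : (fun y => complex.Im (K x y * rkhs_fun v y)) = (fun y =>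
    complex.Re (K x y) * complex.Im (rkhs_fun v y)
    + complex.Im (K x y) * complex.Re (rkhs_fun v y)).
  by apply/funext => z; case: (K x z) => ? ?; case: (rkhs_fun v z).
apply: cvgD; apply: cvgM; [exact: cR|exact: continuous_rkhs_Im|
  exact: cI|exact: continuous_rkhs_Re].
Qed.

End kernel_regularity.

(** * The integral operator as a limit of empirical operators *)

Section integral_operator.
Context (R : realType) (X : ptopologicalType) (rho : probability (borel X) R).
Context (K : X -> X -> R[i]) (H : rkhs K) (B : R).
Hypothesis sc : @second_countable X.
Hypothesis cK : continuous_kernel K.
Hypothesis B0 : 0 <= B.
Hypothesis KB : forall x, K x x <= B%:C.
Local Notation "'[ u , v ]" := (rkhs_inner H u v) : ring_scope.
Local Notation k_ x := (rkhs_section H x).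

Local Notation W := (sq_kernel K : borel X -> borel X -> R).
Local Notation Wc := (centered rho W).

Let WC : forall x y : borel X, W x y = W y x.
Proof. exact: (sq_kernelC H). Qed.

Lemma sq_kernel_bound x y : 0 <= sq_kernel K x y <= B ^+ 2.
Proof.
rewrite (sq_kernelE H) abs2_ge0 /=; apply: le_trans (cauchy_schwarz _ _) _.
by rewrite expr2 ler_pM ?sqn_ge0 // sqn_section.
Qed.

Lemma bounded_mfun_sq_kernel x : bounded_mfun (W x).
Proof.
split.
  apply: (@continuous_measurable1 X R (sq_kernel K x)).
  exact: (continuous_section2 (x := x) (continuous_sq_kernel cK)).
exists (B ^+ 2) => y; case/andP: (sq_kernel_bound x y) => w0 wB.
by rewrite ger0_norm.
Qed.

Lemma kmean_sq_kernel_bound x : 0 <= kmean rho W x <= B ^+ 2.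
Proof.
rewrite /kmean Rintegral_ge0 /=; last by move=> y _; case/andP: (sq_kernel_bound x y).
rewrite -[leRHS](mean_cst rho); apply: mean_le.
- exact: bounded_mfun_sq_kernel.
- exact: bounded_mfun_cst.
- by move=> y; case/andP: (sq_kernel_bound x y).
Qed.

Lemma measurable_sq_kernel2 :
  measurable_fun setT (fun p : borel X * borel X => W p.1 p.2).
Proof. exact: (continuous_measurable2 sc (continuous_sq_kernel cK)). Qed.

Lemma bounded_mfun_kmean : bounded_mfun (kmean rho W).
Proof.
split; last first.
  exists (B ^+ 2) => x; case/andP: (kmean_sq_kernel_bound x) => w0 wB.
  by rewrite ger0_norm.
rewrite /kmean /Rintegral.
apply: (measurableT_comp (fine_measurable measurableT)).
pose f (p : borel X * borel X) := (W p.1 p.2)%:E.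
apply: (measurable_fun_fubini_tonelli_F (m2 := rho) f).
  by apply/measurable_EFinP; exact: measurable_sq_kernel2.
by move=> p; rewrite lee_fin; case/andP: (sq_kernel_bound p.1 p.2).
Qed.

Lemma centered_diag_bound x : Wc x x <= 2 * B ^+ 2.
Proof.
have /andP[_ w1] := sq_kernel_bound x x.
have /andP[w2 _] := kmean_sq_kernel_bound x.
have w3 : kmean2 rho W <= B ^+ 2.
  rewrite -[leRHS](mean_cst rho); apply: mean_le.
  - exact: bounded_mfun_kmean.
  - exact: bounded_mfun_cst.
  - by move=> y; case/andP: (kmean_sq_kernel_bound y).
rewrite /centered; lra.
Qed.

Lemma centered_sq_kernel_psd s : 0 <= quad_form Wc s.
Proof.
apply: (@centered_psd _ _ (borel X) rho W WC bounded_mfun_sq_kernel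
  bounded_mfun_kmean _ centered_diag_bound) => t _; exact: (sq_kernel_psd H).
Qed.

(** The triangle inequality through T: two empirical operators are as close as
    their distances to T allow. *)
Lemma quad_form_diff (s t : seq (R * borel X)) : mass s = 1 -> mass t = 1 ->
  quad_form (sq_kernel K) (s ++ negw t) <= 2 * quad_form Wc s + 2 * quad_form Wc t.
Proof.
move=> s1 t1; rewrite -(@quad_form_centered _ _ (borel X) rho W); last first.
  by rewrite mass_cat mass_neg s1 t1 subrr.
apply: quad_form_diff_le2; last exact: centered_sq_kernel_psd.
exact: (@centeredC _ _ (borel X) rho W WC).
Qed.

Context (T : H -> H).
Hypothesis TI : is_integral_operator rho T.

Lemma empirical_discrepancy : exists z : forall n, 'I_n.+1 -> X,
  forall n, quad_form Wc (empirical n.+1%:R^-1 (z n)) <= 2 * B ^+ 2 / n.+1%:R.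
Proof.
have h n := @herding _ _ (borel X) rho W WC bounded_mfun_sq_kernel
  bounded_mfun_kmean _ centered_diag_bound _ (ltn0Sn n).
by exists (fun n => sval (cid (h n))) => n; exact: (svalP (cid (h n))).
Qed.

Section approximation.
Context (z : forall n, 'I_n.+1 -> X).
Hypothesis zP : forall n,
  quad_form Wc (empirical n.+1%:R^-1 (@z n)) <= 2 * B ^+ 2 / n.+1%:R.
Let s n : seq (R * X) := empirical n.+1%:R^-1 (@z n).

Lemma double_discrepancy n : 2 * quad_form Wc (s n) <= 4 * B ^+ 2 / n.+1%:R.
Proof.
have -> : 4 * B ^+ 2 / n.+1%:R = 2 * (2 * B ^+ 2 / n.+1%:R) by ring.
by rewrite ler_pM2l // zP.
Qed.

Lemma sampling_cauchy v : exists l : H,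
  (fun n => sampling_operator (s n) v) @ \oo --> l.
Proof.
pose u n := sampling_operator (s n) v.
have uu n m : sqn (u n - u m) <=
    sqn v * (4 * B ^+ 2) / n.+1%:R + sqn v * (4 * B ^+ 2) / m.+1%:R.
  rewrite /u -sampling_neg -sampling_cat; apply: le_trans (hs_sampling _ _) _.
  rewrite -[X in _ <= X + _]mulrA -[X in _ <= _ + X]mulrA -mulrDr.
  rewrite ler_wpM2l ?sqn_ge0 //.
  apply: le_trans (quad_form_diff (mass_empirical _ _) (mass_empirical _ _)) _.
  by rewrite lerD // double_discrepancy.
apply/cvg_ex; apply/cauchy_cvgP; apply: cauchy_exP => e e0.
case: e e0 => r i; rewrite ltcE /= => /andP[/eqP -> r0].
have r2 : 0 < r ^+ 2 / 2 by rewrite divr_gt0 ?exprn_gt0.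
have /cvgr0Pnorm_lt/(_ _ r2) [N _ hN] := @harmonic_bound_cvg R 0 (sqn v * (4 * B ^+ 2)).
exists (u N); exists N => // n Nn /=.
have small m : (N <= m)%N -> sqn v * (4 * B ^+ 2) / m.+1%:R < r ^+ 2 / 2.
  by move=> /hN /=; rewrite add0r; apply: le_lt_trans; exact: ler_norm.
rewrite -ball_normE /ball_ /= norm_sqnE ltcR.
rewrite -[ltRHS]ger0_norm ?ltW // -sqrtr_sqr ltr_sqrt ?exprn_gt0 //.
apply: le_lt_trans (uu _ _) _.
by rewrite [ltRHS]splitr ltrD ?small.
Qed.

Lemma sampling_fun (t : seq (R * X)) v x :
  '[sampling_operator t v, k_ x]
  = \sum_(p <- t) p.1%:C * (K x p.2 * rkhs_fun v p.2).
Proof.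
rewrite ip_suml; apply: eq_bigr => p _.
by rewrite ipZl ip_section rkhs_reproducing; ring.
Qed.

Lemma bounded_integrand (v : H) (x : X) :
  bounded_mfun (fun y : borel X => complex.Re (K x y * rkhs_fun v y)) /\
  bounded_mfun (fun y : borel X => complex.Im (K x y * rkhs_fun v y)).
Proof.
have [c1 c2] := continuous_integrand cK x v.
have bd y : abs2 (K x y * rkhs_fun v y) <= B ^+ 2 * (sqn v * B).
  rewrite abs2M ler_pM ?abs2_ge0 //; first by case/andP: (sq_kernel_bound x y).
  rewrite rkhs_reproducing; apply: le_trans (cauchy_schwarz _ _) _.
  by rewrite ler_wpM2l ?sqn_ge0 // sqn_section.
have bd' (r : R) y : r ^+ 2 <= abs2 (K x y * rkhs_fun v y) ->
    `|r| <= Num.sqrt (B ^+ 2 * (sqn v * B)).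
  by move=> h; rewrite -sqrtr_sqr ler_wsqrtr // (le_trans h).
split; split; try exact: continuous_measurable1.
  exists (Num.sqrt (B ^+ 2 * (sqn v * B))) => y.
  by apply: (bd' _ y); rewrite /abs2 lerDl sqr_ge0.
exists (Num.sqrt (B ^+ 2 * (sqn v * B))) => y.
by apply: (bd' _ y); rewrite /abs2 lerDr sqr_ge0.
Qed.

(** [Re <S v, K_x>] is a weighted sum of values of the integrand defining
    [(T v)(x)], and its square is at most [K(x,x) |v|^2] times the squared
    Hilbert-Schmidt norm; so mean_error_bound compares the sum with the integral. *)
Lemma sampling_mean_error (v : H) (x : X) n :
  (complex.Re '[sampling_operator (s n) v, k_ x] - complex.Re (rkhs_fun (T v) x)) ^+ 2
    <= B * sqn v * (2 * B ^+ 2) / n.+1%:R /\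
  (complex.Im '[sampling_operator (s n) v, k_ x] - complex.Im (rkhs_fun (T v) x)) ^+ 2
    <= B * sqn v * (2 * B ^+ 2) / n.+1%:R.
Proof.
have [b1 b2] := bounded_integrand v x.
have C0 : 0 <= B * sqn v by rewrite mulr_ge0 ?sqn_ge0.
have key (r : seq (R * X)) : abs2 '[sampling_operator r v, k_ x]
    <= B * sqn v * quad_form (sq_kernel K) r.
  apply: le_trans (cauchy_schwarz _ _) _; rewrite mulrC -mulrA.
  by apply: ler_pM; rewrite ?sqn_ge0 ?sqn_section // hs_sampling.
have re (t : seq (R * X)) : complex.Re '[sampling_operator t v, k_ x]
    = \sum_(p <- t) p.1 * complex.Re (K x p.2 * rkhs_fun v p.2).
  rewrite sampling_fun Re_sum; apply: eq_bigr => p _.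
  by case: (K x p.2 * _) => a b /=; ring.
have im (t : seq (R * X)) : complex.Im '[sampling_operator t v, k_ x]
    = \sum_(p <- t) p.1 * complex.Im (K x p.2 * rkhs_fun v p.2).
  rewrite sampling_fun Im_sum; apply: eq_bigr => p _.
  by case: (K x p.2 * _) => a b /=; ring.
rewrite TI re im /cintegral /=; split.
  apply: le_trans (@mean_error_bound _ _ (borel X) rho W _ _ _ WC
    bounded_mfun_sq_kernel bounded_mfun_kmean centered_diag_bound b1 C0 _ _
    (mass_empirical _ _)) _.
    by move=> t; apply: le_trans (key t); rewrite -re /abs2 lerDl sqr_ge0.
  by rewrite -[leRHS]mulrA ler_wpM2l.
apply: le_trans (@mean_error_bound _ _ (borel X) rho W _ _ _ WC
    bounded_mfun_sq_kernel bounded_mfun_kmean centered_diag_bound b2 C0 _ _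
    (mass_empirical _ _)) _.
  by move=> t; apply: le_trans (key t); rewrite -im /abs2 lerDr sqr_ge0.
by rewrite -[leRHS]mulrA ler_wpM2l.
Qed.

(** The vectors have a limit by completeness; it is [T v] since both have the
    same values at every point and elements of H are determined by their values. *)
Lemma sampling_cvg v : (fun n => sampling_operator (s n) v) @ \oo --> T v.
Proof.
have [l cl] := sampling_cauchy v.
suff -> : T v = l by [].
apply: (@rkhs_fun_inj _ _ _ H); apply/funext => x.
have cR : complex.Re '[sampling_operator (s n) v, k_ x] @[n --> \oo] -->
    complex.Re (rkhs_fun (T v) x).
  by apply: cvg_sq_harmonic => n; exact: (sampling_mean_error v x n).1.
have cI : complex.Im '[sampling_operator (s n) v, k_ x] @[n --> \oo] -->
    complex.Im (rkhs_fun (T v) x).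
  by apply: cvg_sq_harmonic => n; exact: (sampling_mean_error v x n).2.
have eR := cvg_unique (@norm_hausdorff _ _) cR (cvg_re_ip (v := k_ x) cl).
have cl' : complex.Im '[sampling_operator (s n) v, k_ x] @[n --> \oo] -->
    complex.Im '[l, k_ x].
  by rewrite im_ip; under eq_fun do rewrite im_ip; exact: cvg_re_ip.
have eI := cvg_unique (@norm_hausdorff _ _) cI cl'.
rewrite (rkhs_reproducing l).
by case: (rkhs_fun (T v) x) eR eI => a b /= -> ->; case: '[l, k_ x].
Qed.

End approximation.

(** The quadratic forms of empirical operators take values between 0 and
    [B * |e|^2] at [e], and this passes to the limit. *)
Lemma integral_operator_eig_bound (e : H) lam : e != 0 -> T e = lam%:C *: e ->
  0 <= lam <= B.
Proof.
move=> e0 Te; have [z zP] := empirical_discrepancy.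
have := cvg_re_ip (v := e) (@sampling_cvg _ zP e).
have -> : complex.Re '[T e, e] = lam * sqn e.
  by rewrite Te ipZl ip_self /=; ring.
have bnd n : 0 <= complex.Re '[sampling_operator (empirical n.+1%:R^-1 (@z n)) e, e]
    <= B * sqn e.
  have -> : complex.Re '[sampling_operator (empirical n.+1%:R^-1 (@z n)) e, e] =
      n.+1%:R^-1 * \sum_i abs2 '[e, k_ (z n i)].
    rewrite ip_suml Re_sum big_map big_enum mulr_sumr; apply: eq_bigr => i _.
    by rewrite ipZl /= -mulrA (ipC e) -abs2_conj /=; ring.
  rewrite mulr_ge0 ?invr_ge0 //= ?sumr_ge0 //; last by move=> i _; exact: abs2_ge0.
  rewrite mulrC ler_pdivrMr ?ltr0n // mulr_natr -[X in _ *+ X](card_ord n.+1).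
  rewrite -sumr_const; apply: ler_sum => i _.
  apply: le_trans (cauchy_schwarz _ _) _.
  by rewrite mulrC ler_wpM2r ?sqn_ge0 // sqn_section.
move=> c; have e1 := sqn_gt0 e0.
apply/andP; split; rewrite -(ler_pM2r e1) ?mul0r.
  rewrite -oppr_le0; apply: (cvg_le_cst (cvgN c)) => n; rewrite oppr_le0.
  by case/andP: (bnd n).
by apply: (cvg_le_cst c) => n; case/andP: (bnd n).
Qed.

(** The bound holds for the difference of two sampling operators and passes to
    the limit along the herded configurations.  The factor 2 comes from the
    parallelogram inequality. *)
Lemma integral_operator_hs N (x : 'I_N.+1 -> X) M (f : 'I_M -> H) : orthonormal0 f ->
  \sum_m sqn (T (f m) - empirical_operator x (f m)) <=
  2 * quad_form Wc (empirical N.+1%:R^-1 x).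
Proof.
move=> fo; have [z zP] := empirical_discrepancy.
pose u n := \sum_m sqn (sampling_operator (empirical n.+1%:R^-1 (@z n)) (f m)
   - empirical_operator x (f m)).
apply: (@cvg_le_harmonic R u _ _ (4 * B ^+ 2)).
  apply: cvg_real_sum => m; apply: cvg_sqn; apply: cvgB; last exact: cvg_cst.
  exact: (@sampling_cvg _ zP).
move=> n; rewrite /u.
under eq_bigr do rewrite empirical_sampling -sampling_neg -sampling_cat.
apply: le_trans (hs_bessel _ fo) _.
apply: le_trans (quad_form_diff (mass_empirical _ _) (mass_empirical _ _)) _.
by rewrite addrC lerD2l; exact: double_discrepancy.
Qed.

End integral_operator.

(** * Integrating out one sample *)

Section independence.
Context (R : realType) d (Omega : measurableType d) (P : probability Omega R).
Context dY (Y : measurableType dY) (rho : probability Y R).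
Context (N : nat) (x : 'I_N -> Omega -> Y).
Hypothesis mx : forall i, measurable_fun setT (x i).
Hypothesis law : forall i B, measurable B -> P (x i @^-1` B) = rho B.
Hypothesis indep : forall (B : 'I_N -> set Y) (J : {set 'I_N}),
  (forall i, measurable (B i)) ->
  P (\bigcap_(i in [set` J]) (x i @^-1` B i)) = (\prod_(i in J) P (x i @^-1` B i))%E.

Section past.
Context (J : {set 'I_N}) (i : 'I_N).
Hypothesis iJ : i \notin J.

(** They generate the sigma-algebra of the samples with index in [J]. *)
Definition cylinders : set (set Omega) := [set A | exists B : 'I_N -> set Y,
  (forall j, measurable (B j)) /\ A = \bigcap_(j in [set` J]) (x j @^-1` B j)].

Lemma measurable_preim j B : measurable B -> measurable (x j @^-1` B).
Proof. by move=> mB; rewrite -[X in measurable X]setTI; exact: mx. Qed.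

Lemma cylinders_measurable : cylinders `<=` measurable.
Proof.
move=> _ [B [mB ->]]; apply: fin_bigcap_measurable => // j _.
exact: measurable_preim.
Qed.

Lemma cylinders_setI : setI_closed cylinders.
Proof.
move=> _ _ [B [mB ->]] [C [mC ->]]; exists (fun j => B j `&` C j); split.
  by move=> j; exact: measurableI.
by rewrite -bigcapI.
Qed.

Lemma cylinders_setT : cylinders setT.
Proof.
exists (fun=> setT); split => //.
by apply/seteqP; split.
Qed.

(** Both sides are finite measures in [A], equal on the cylinders, which are
    stable under intersection. *)
Lemma cylinder_indep A C : <<s cylinders >> A -> measurable C ->
  (P (A `&` x i @^-1` C) = P A * rho C)%E.
Proof.
move=> sA mC; have mxC := measurable_preim i mC.
pose r : {nonneg R} := NngNum (fine_ge0 (measure_ge0 rho C)).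
have rE : (r%:num%:E = rho C)%E by rewrite /= fineK //; exact: fin_num_measure.
suff : mrestr P mxC A = mscale r P A.
  by rewrite /mrestr /mscale rE muleC.
apply: (@g_sigma_algebra_measure_unique _ _ _ cylinders cylinders_measurable
  (fun=> setT) (fun=> cylinders_setT) _ (mrestr P mxC) (mscale r P)
  cylinders_setI _ _ A sA).
- by rewrite bigcup_const //; exists 0%N.
- move=> _ [B [mB ->]]; transitivity (P (\bigcap_(j in [set` J]) x j @^-1` B j `&` x i @^-1` C)) => //.
  transitivity (rho C * P (\bigcap_(j in [set` J]) x j @^-1` B j))%E; last first.
    by rewrite -rE.
  pose B' j := if j == i then C else B j.
  have mB' j : measurable (B' j) by rewrite /B'; case: eqP.
  have -> : \bigcap_(j in [set` J]) x j @^-1` B j `&` x i @^-1` C =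
      \bigcap_(j in [set` (i |: J)%SET]) x j @^-1` B' j.
    apply/seteqP; split=> [w [wB wC] j /=|w wB].
      rewrite /B'; case: eqP => [->//|ji]; rewrite in_setU1 => /orP[/eqP//|jJ].
      exact: wB.
    split=> [j /= jJ|].
      have := wB j; rewrite /= /B' in_setU1 jJ orbT => /(_ isT).
      by case: eqP => // ji; move: jJ; rewrite ji (negPf iJ).
    by have := wB i; rewrite /= /B' in_setU1 !eqxx => /(_ isT).
  rewrite (indep _ mB') (indep _ mB).
  rewrite big_setU1 //= {1}/B' eqxx law //; congr (_ * _)%E.
  apply: eq_bigr => j jJ; rewrite /B'; case: eqP => // ji.
  by move: jJ; rewrite ji (negPf iJ).
- move=> _; have : (P (setT `&` x i @^-1` C) < +oo)%E => //.
  by rewrite setTI; apply: le_lt_trans (probability_le1 _ mxC) (ltry _).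
Qed.

Let Past := g_sigma_algebraType cylinders.

Let past (w : Omega) : Past := w.

Lemma measurable_past : measurable_fun setT past.
Proof.
move=> _ A mA; rewrite setTI.
exact: (smallest_sub (@sigma_algebra_measurable _ Omega) cylinders_measurable) mA.
Qed.

Lemma measurable_past_coord j : j \in J ->
  measurable_fun setT (x j : Past -> Y).
Proof.
move=> jJ _ B mB; rewrite setTI; apply: sub_sigma_algebra.
exists (fun k => if k == j then B else setT); split.
  by move=> k; case: eqP.
apply/seteqP; split=> [w wB k /= kJ|w /(_ j jJ) /=]; first by case: eqP => [->|].
by rewrite eqxx.
Qed.

(** The law of the pair formed by the past and the i-th sample is a product
    measure, so that sample can be integrated out first. *)
Lemma tonelli_past (f : Past * Y -> \bar R) : measurable_fun setT f ->
  (forall p, 0 <= f p)%E ->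
  (\int[P]_w f (w, x i w) = \int[P]_w \int[rho]_y f (w, y))%E.
Proof.
move=> mf f0.
pose past_mfun : {mfun Omega >-> Past} :=
  HB.pack past (isMeasurableFun.Build _ _ _ _ _ measurable_past).
pose m1 : probability Past R := distribution P past_mfun.
pose pr (w : Omega) : Past * Y := (past w, x i w).
have mpr : measurable_fun setT pr.
  by apply/measurable_fun_pairP; split; [exact: measurable_past|exact: mx].
pose m' := pushforward P pr.
transitivity (\int[pushforward P pr]_p f p)%E.
  by rewrite ge0_integral_pushforward // => p _; exact: f0.
transitivity (\int[m1 \x rho]_p f p)%E.
  apply: eq_measure_integral => A mA _; symmetry.
  apply: (@product_measure_unique _ _ _ _ R m1 rho) => // B C mB mC.
  by rewrite -cylinder_indep.
rewrite fubini_tonelli1 // /m1.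
rewrite ge0_integral_pushforward //.
  exact: measurable_fun_fubini_tonelli_F.
by move=> w _; apply: integral_ge0 => y _; exact: f0.
Qed.

End past.
End independence.

(** * Exponential tail of the sample energy *)

Section concentration.
Context (R : realType).

Lemma expR_neg_le (u : R) : u < 1 -> expR u <= (1 - u)^-1.
Proof.
move=> u1; have h : 0 < 1 - u by rewrite subr_gt0.
rewrite -[u in expR u]opprK expRN lef_pV2 ?posrE ?expR_gt0 //.
exact: expR_ge1Dx.
Qed.

(** Trades the linear term of the exponential, which averages out, for a
    square. *)
Lemma expR_le_quad (u : R) : expR u <= u + expR (2 * u ^+ 2).
Proof.
have [u2|u2] := leP (2^-1) u.
  have u0 : 0 <= u by apply: le_trans u2.
  rewrite -[leLHS]add0r lerD // ler_expR; nra.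
have u1 : u < 1 by apply: lt_trans u2 _; lra.
have h : 0 < 1 - u by rewrite subr_gt0.
apply: le_trans (expR_neg_le u1) _.
apply: le_trans (_ : u + (1 + 2 * u ^+ 2) <= _); last first.
  by rewrite lerD2l; exact: expR_ge1Dx.
rewrite -[leLHS]mul1r ler_pdivrMr //.
have : 0 <= u ^+ 2 * (1 - 2 * u) by rewrite mulr_ge0 ?sqr_ge0 //; lra.
nra.
Qed.

Lemma expR_eighth : expR (8^-1 : R) < 2.
Proof.
apply: le_lt_trans (expR_neg_le _) _; first by lra.
have -> : (1 - 8^-1 : R)^-1 = 8 / 7 by field.
lra.
Qed.

Context d (Omega : measurableType d) (P : probability Omega R).
Context dY (Y : measurableType dY) (rho : probability Y R).
Context (N : nat) (x : 'I_N -> Omega -> Y).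
Hypothesis mx : forall i, measurable_fun setT (x i).
Hypothesis law : forall i B, measurable B -> P (x i @^-1` B) = rho B.
Hypothesis indep : forall (B : 'I_N -> set Y) (J : {set 'I_N}),
  (forall i, measurable (B i)) ->
  P (\bigcap_(i in [set` J]) (x i @^-1` B i)) = (\prod_(i in J) P (x i @^-1` B i))%E.
Context (phi : Y -> Y -> R) (M : R).
Hypothesis phiC : forall y z, phi y z = phi z y.
Hypothesis phim : measurable_fun setT (fun p : Y * Y => phi p.1 p.2).
Hypothesis phib : forall y, bounded_mfun (phi y).
Hypothesis phi_psd : forall s, 0 <= quad_form phi s.
Hypothesis phi0 : forall y, \int[rho]_z phi y z = 0.
Hypothesis M0 : 0 < M.
Hypothesis phiM : forall y, phi y y <= M.

(** The Cauchy-Schwarz inequality for the positive form, at the optimal weight of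
    [y]. *)
Lemma cross_le s y : (\sum_(q <- s) q.1 * phi q.2 y) ^+ 2 <= M * quad_form phi s.
Proof.
set p := \sum_(q <- s) _.
have := phi_psd ((- p / M, y) :: s); rewrite quad_form_cons // -/p => h.
have : quad_form phi s + 2 * (- p / M) * p + (- p / M) ^+ 2 * M >= 0.
  by apply: le_trans h _; rewrite lerD2l ler_wpM2l ?sqr_ge0.
have -> : quad_form phi s + 2 * (- p / M) * p + (- p / M) ^+ 2 * M
    = (M * quad_form phi s - p ^+ 2) / M by field; rewrite gt_eqF.
by rewrite pmulr_lge0 ?invr_gt0 // subr_ge0.
Qed.

(** Equals [N^2] times the squared distance between the empirical and the
    integral operator, when [phi] is the centered [|K|^2] and [r] lists all
    indices. *)
Definition sample_energy (r : seq 'I_N) w : R :=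
  quad_form phi [seq (1, x j w) | j <- r].

Lemma sample_energy_cons i r w : sample_energy (i :: r) w =
  sample_energy r w + 2 * (\sum_(j <- r) phi (x j w) (x i w)) + phi (x i w) (x i w).
Proof.
rewrite /sample_energy /= quad_form_cons // expr1n mul1r mulr1 big_map.
by congr (_ + 2 * _ + _); apply: eq_bigr => j _; rewrite mul1r.
Qed.

Lemma measurable_sum_fun dT (T : measurableType dT) (I : eqType) (r : seq I)
  (F : I -> T -> R) : (forall i, i \in r -> measurable_fun setT (F i)) ->
  measurable_fun setT (fun t => \sum_(i <- r) F i t).
Proof.
elim: r => [|i r IH] mF.
  by under eq_fun do rewrite big_nil; exact: measurable_cst.
under eq_fun do rewrite big_cons; apply: measurable_funD.
  by apply: mF; rewrite mem_head.
by apply: IH => j jr; apply: mF; rewrite in_cons jr orbT.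
Qed.

Lemma measurable_phi dT (T : measurableType dT) (f g : T -> Y) :
  measurable_fun setT f -> measurable_fun setT g ->
  measurable_fun setT (fun t => phi (f t) (g t)).
Proof.
move=> mf mg; apply: (measurableT_comp phim (g := fun t => (f t, g t))).
by apply/measurable_fun_pairP.
Qed.

Lemma measurable_energy dT (T : measurableType dT) r (y : 'I_N -> T -> Y) :
  (forall j, j \in r -> measurable_fun setT (y j)) ->
  measurable_fun setT (fun t => quad_form phi [seq (1, y j t) | j <- r]).
Proof.
move=> my; rewrite /quad_form; under eq_fun do rewrite big_map.
apply: measurable_sum_fun => j jr; under eq_fun do rewrite big_map.
apply: measurable_sum_fun => k kr /=; under eq_fun do rewrite !mul1r.
by apply: measurable_phi; exact: my.
Qed.

(** In the cross term [u = 2 th p(y)] the linear part has mean zero and the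
    quadratic one is bounded by cross_le, so a new point multiplies the
    exponential by [e^(th M)] and raises its exponent by a factor
    [1 + 8 th M]. *)
Lemma conditional_mgf (s : seq (R * Y)) (th : R) : 0 <= th ->
  (\int[rho]_y (expR (th * (quad_form phi s
     + 2 * (\sum_(q <- s) q.1 * phi q.2 y) + phi y y)))%:E <=
   (expR (th * M + (th + 8 * th ^+ 2 * M) * quad_form phi s))%:E)%E.
Proof.
move=> th0; set V := quad_form phi s; pose p y := \sum_(q <- s) q.1 * phi q.2 y.
have V0 : 0 <= V by exact: phi_psd.
pose a := expR (th * (V + M)).
pose b := expR (8 * th ^+ 2 * (M * V)).
have bp : bounded_mfun p.
  by apply: bounded_mfun_sum => q; exact: bounded_mfunZ.
pose g y := a * (2 * th) * p y + a * b.
have bg : bounded_mfun g.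
  by apply: bounded_mfunD; [exact: bounded_mfunZ|exact: bounded_mfun_cst].
have le_g y : expR (th * (V + 2 * p y + phi y y)) <= g y.
  have -> : g y = a * (2 * th * p y + b) by rewrite /g; ring.
  apply: le_trans (_ : a * expR (2 * th * p y) <= _).
    rewrite -expRD ler_expR.
    have : th * phi y y <= th * M by rewrite ler_wpM2l.
    nra.
  rewrite ler_wpM2l ?expR_ge0 //; apply: le_trans (expR_le_quad _) _.
  rewrite lerD2l ler_expR.
  have -> : 2 * (2 * th * p y) ^+ 2 = 8 * th ^+ 2 * p y ^+ 2 by ring.
  by rewrite ler_wpM2l ?mulr_ge0 ?sqr_ge0 // cross_le.
have gi := bounded_mfun_integrable rho bg.
have gE : (\int[rho]_y (g y)%:E = (a * b)%:E)%E.
  have fi : (\int[rho]_y (g y)%:E)%E \is a fin_num by exact: integrable_fin_num.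
  have e1 : bounded_mfun (fun y => a * (2 * th) * p y) by exact: bounded_mfunZ.
  have e2 := bounded_mfun_cst Y (a * b).
  rewrite -(fineK fi) -/(Rintegral _ _ _) (meanD rho e1 e2) (meanZ rho _ bp).
  rewrite mean_cst mean_sum; last by move=> q; exact: bounded_mfunZ.
  rewrite big1 ?mulr0 ?add0r // => q _.
  by rewrite (meanZ rho q.1 (phib q.2)) phi0 mulr0.
have -> : expR (th * M + (th + 8 * th ^+ 2 * M) * V) = a * b.
  by rewrite /a /b -expRD; congr expR; ring.
rewrite -gE; apply: ge0_le_integral => //.
- apply/measurable_EFinP; apply: (measurableT_comp (@measurable_expR R)).
  apply: measurable_funM; first exact: measurable_cst.
  apply: measurable_funD.
    apply: measurable_funD; first exact: measurable_cst.
    by apply: measurable_funM; [exact: measurable_cst|case: bp].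
  by apply: measurable_phi; exact: measurable_id.
- by apply/measurable_EFinP; case: bg.
- by move=> y _; rewrite lee_fin; exact: le_g.
Qed.

Lemma mgf_step i r (th : R) : i \notin r -> 0 <= th ->
  (\int[P]_w (expR (th * sample_energy (i :: r) w))%:E <=
   (expR (th * M))%:E *
     \int[P]_w (expR ((th + 8 * th ^+ 2 * M) * sample_energy r w))%:E)%E.
Proof.
move=> ir th0; pose J := [set j in r]%SET.
have iJ : i \notin J by rewrite inE.
pose Past := g_sigma_algebraType (cylinders x J).
pose f (p : Past * Y) := (expR (th * (sample_energy r p.1
   + 2 * (\sum_(j <- r) phi (x j p.1) p.2) + phi p.2 p.2)))%:E.
have mcoord j : j \in r -> measurable_fun setT (fun p : Past * Y => x j p.1).
  move=> jr; apply: (@measurableT_comp _ _ _ _ _ _ (x j : Past -> Y)).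
    by apply: measurable_past_coord; rewrite inE.
  exact: measurable_fst.
have mf : measurable_fun setT f.
  apply/measurable_EFinP; apply: (measurableT_comp (@measurable_expR R)).
  apply: measurable_funM; first exact: measurable_cst.
  apply: measurable_funD.
    apply: measurable_funD.
      exact: (@measurable_energy _ (Past * Y)%type r (fun j p => x j p.1)).
    apply: measurable_funM; first exact: measurable_cst.
    apply: measurable_sum_fun => j jr; apply: measurable_phi.
      exact: mcoord.
    exact: measurable_snd.
  by apply: measurable_phi; exact: measurable_snd.
have f0 p : (0 <= f p)%E by rewrite lee_fin expR_ge0.
have -> : (\int[P]_w (expR (th * sample_energy (i :: r) w))%:E
   = \int[P]_w f (w, x i w))%E.
  by apply: eq_integral => w _; rewrite sample_energy_cons.
rewrite (tonelli_past mx law indep iJ mf f0).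
rewrite -ge0_integralZl_EFin ?expR_ge0 //; last first.
  apply/measurable_EFinP; apply: (measurableT_comp (@measurable_expR R)).
  apply: measurable_funM; first exact: measurable_cst.
  by apply: measurable_energy.
apply: ge0_le_integral => //.
- by move=> w _; apply: integral_ge0 => y _; exact: f0.
- apply: (@measurableT_comp _ _ _ Omega Past _ (fubini_F rho f)).
    exact: measurable_fun_fubini_tonelli_F.
  exact: (measurable_past mx (J := J)).
- apply/measurable_EFinP; apply: measurable_funM; first exact: measurable_cst.
  apply: (measurableT_comp (@measurable_expR R)).
  apply: measurable_funM; first exact: measurable_cst.
  by apply: measurable_energy.
- move=> w _; rewrite -EFinM -expRD.
  apply: le_trans (conditional_mgf [seq (1, x j w) | j <- r] th0).
  rewrite le_eqVlt; apply/orP; left; apply/eqP; apply: eq_integral => y _.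
  rewrite /f /sample_energy big_map /=; under [in RHS]eq_bigr do rewrite mul1r.
  by [].
Qed.

(** Each step replaces [th] by [th + 8 th^2 M].  The hypothesis says that the
    product of [th M] and the number of remaining steps is at most 1/16; it is
    preserved when a step is taken, and it keeps the accumulated exponent below
    twice its first-order value. *)
Lemma mgf_energy r (th : R) : uniq r -> 0 <= th -> 16 * (size r)%:R * (th * M) <= 1 ->
  (\int[P]_w (expR (th * sample_energy r w))%:E
    <= (expR (2 * (size r)%:R * (th * M)))%:E)%E.
Proof.
elim: r th => [|i r IH] th /=.
  move=> _ _ _; rewrite mulr0 mul0r.
  have -> : (fun w => (expR (th * sample_energy [::] w))%:E) = cst 1%E.
    by apply/funext => w; rewrite /sample_energy /quad_form /= big_nil mulr0 expR0.
  by rewrite integral_cst // mul1e [X in (X <= _)%E](@probability_setT _ _ _ P) expR0.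
move=> /andP[ir ur] th0; rewrite -(natr1 (size r)) => small.
have th'0 : 0 <= th + 8 * th ^+ 2 * M.
  by rewrite addr_ge0 // !mulr_ge0 ?sqr_ge0 // ltW.
have u0 : 0 <= th * M by rewrite mulr_ge0 // ltW.
have n0 : 0 <= (size r)%:R :> R by rewrite ler0n.
have small1 : 16 * (size r)%:R * (th * M) <= 1 by nra.
have sq : 16 * (size r)%:R * (th * M) * (th * M) <= th * M.
  by rewrite ler_piMl.
apply: le_trans (mgf_step ir th0) _.
have -> : 2 * ((size r)%:R + 1) * (th * M) = th * M + (2 * (size r)%:R + 1) * (th * M) by ring.
rewrite expRD EFinM lee_wpmul2l ?lee_fin ?expR_ge0 //.
apply: le_trans (IH _ ur th'0 _) _.
  have -> : 16 * (size r)%:R * ((th + 8 * th ^+ 2 * M) * M)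
     = 16 * (size r)%:R * (th * M) + 8 * (16 * (size r)%:R * (th * M) * (th * M)) by ring.
  lra.
rewrite lee_fin ler_expR.
have -> : 2 * (size r)%:R * ((th + 8 * th ^+ 2 * M) * M)
     = 2 * (size r)%:R * (th * M) + 16 * (size r)%:R * (th * M) * (th * M) by ring.
lra.
Qed.

Lemma measurable_energy_ge (a : R) :
  measurable [set w | a <= sample_energy (enum 'I_N) w].
Proof.
rewrite -[X in measurable X]setTI (_ : [set w | _] =
    sample_energy (enum 'I_N) @^-1` `[a, +oo[).
  by apply: measurable_energy.
by apply/seteqP; split=> w /=; rewrite in_itv /= andbT.
Qed.

(** The Markov inequality at the largest exponent allowed by mgf_energy, where
    the exponential moment is at most [e^(1/8) < 2]. *)
Lemma energy_tail (t : R) : (0 < N)%N -> 0 <= t ->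
  (P [set w | (16 * N%:R * M * t <= sample_energy (enum 'I_N) w)%R]
    < (2 * expR (- t))%:E)%E.
Proof.
move=> N0 t0; set A := [set w | _].
have Np : 0 < N%:R :> R by rewrite ltr0n.
pose th : R := (16 * N%:R * M)^-1.
have d0 : 0 < 16 * N%:R * M by rewrite !mulr_gt0.
have th0 : 0 <= th by rewrite invr_ge0 ltW.
pose f w := (expR (th * sample_energy (enum 'I_N) w))%:E.
have mV : measurable_fun setT (sample_energy (enum 'I_N)).
  by apply: measurable_energy.
have mA : measurable A by exact: measurable_energy_ge.
have mf : measurable_fun setT f.
  apply/measurable_EFinP; apply: (measurableT_comp (@measurable_expR R)).
  by apply: measurable_funM => //; exact: measurable_cst.
have f0 w : (0 <= f w)%E by rewrite lee_fin expR_ge0.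
have fle : (\int[P]_w f w <= (expR 8^-1)%:E)%E.
  apply: le_trans (mgf_energy (enum_uniq _) th0 _) _; rewrite size_enum_ord.
    by rewrite le_eqVlt; apply/orP; left; apply/eqP; rewrite /th; field; rewrite !gt_eqF.
  by rewrite lee_fin ler_expR le_eqVlt; apply/orP; left; apply/eqP; rewrite /th; field; rewrite !gt_eqF.
have : ((expR t)%:E * P A <= (expR 8^-1)%:E)%E.
  apply: le_trans fle; apply: le_trans (_ : \int[P]_(w in A) f w <= _)%E; last first.
    by apply: ge0_subset_integral => // w _; exact: f0.
  rewrite -integral_cst //; apply: ge0_le_integral => //.
  - by move=> w _; rewrite lee_fin expR_ge0.
  - exact: measurable_funTS.
  - move=> w /= Aw; rewrite lee_fin ler_expR.
    by rewrite /th mulrC ler_pdivlMr // mulrC.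
move=> h; rewrite expRN.
have PA : P A \is a fin_num by exact: fin_num_measure.
rewrite -(fineK PA) -EFinM lee_fin in h.
rewrite -(fineK PA) lte_fin ltr_pdivlMr ?expR_gt0 // mulrC.
by apply: le_lt_trans h expR_eighth.
Qed.

End concentration.

(** * Measurability of the reconstruction error *)

Section reconstruction_regularity.
Context (R : realType) (X : ptopologicalType) (K : X -> X -> R[i]) (H : rkhs K) (B : R).
Hypothesis B0 : 0 <= B.
Hypothesis KB : forall x, K x x <= B%:C.
Context (g : nat -> R -> R) (tau L : R).
Hypothesis g_mono : forall j l, 0 <= l -> 0 <= g j l <= g j.+1 l.
Let phi (l : R) := l * g (Num.truncn tau) l.
Hypothesis phiL : forall l m : R, 0 <= l <= B -> 0 <= m <= B ->
  (phi l - phi m) ^+ 2 <= L ^+ 2 * (l - m) ^+ 2.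
Context (f : H) (N : nat).
Local Notation rec p := (@mc_reconstruction _ _ _ H g N p tau f).

Lemma reconstruction_stability (A : H -> H) (lam : nat -> R) E (S : R) (p : 'I_N -> X) M :
  spectral_resolution A lam E ->
  (forall n v, E n v != 0 -> 0 <= lam n <= B) ->
  (forall M (e : 'I_M -> H), orthonormal0 e ->
     \sum_m sqn (A (e m) - empirical_operator p (e m)) <= S) ->
  \sum_(0 <= n < M) sqn ((phi (lam n))%:C *: E n f - E n (rec p)) <=
    L ^+ 2 * S * sqn f.
Proof.
move=> resA lamB hs.
have [mu [F [resF muB finF]]] := @empirical_resolution _ _ _ H _ p _ B0 (fun i => KB (p i)).
apply: (calculus_stability resA resF finF lamB muB phiL hs) => n.
by rewrite (proj_reconstruction _ _ resF finF g_mono) //; case/andP: (muB n).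
Qed.

(** The stability bound compares two empirical operators just as well. *)
Lemma reconstruction_lipschitz (p q : 'I_N -> X) :
  sqn (rec p - rec q) <= L ^+ 2 *
    quad_form (sq_kernel K) (empirical N%:R^-1 p ++ negw (empirical N%:R^-1 q)) * sqn f.
Proof.
have [lam [E [resE lamB finE]]] := @empirical_resolution _ _ _ H _ p _ B0 (fun i => KB (p i)).
apply: (parseval_bound resE) => M.
apply: le_trans (@reconstruction_stability _ lam E _ q M resE _ _).
- apply: ler_sum => n _; rewrite (linB _ _ (res_lin resE n)).
  by rewrite (proj_reconstruction _ _ resE finE g_mono) //; case/andP: (lamB n).
- by move=> n _ _; exact: lamB.
- move=> M' e eo; under eq_bigr do
    rewrite !empirical_sampling -sampling_neg -sampling_cat.
  exact: hs_bessel.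
Qed.

Hypothesis cK : continuous_kernel K.

(** On the diagonal [q = p] each summand of the double sum vanishes; by
    continuity it is small on a box. *)
Lemma sq_kernel_box (p : 'I_N -> X) (e : R) : 0 < e ->
  exists U : 'I_N -> set X, (forall i, nbhs (p i) (U i)) /\
   forall q, (forall i, U i (q i)) ->
     quad_form (sq_kernel K) (empirical N%:R^-1 p ++ negw (empirical N%:R^-1 q)) <= e.
Proof.
move=> e0; have d0 : 0 < e / 3 by rewrite divr_gt0.
have cW i j : exists V : set X * set X, [/\ nbhs (p i) V.1, nbhs (p j) V.2 &
    forall y z, V.1 y -> V.2 z -> `|sq_kernel K (p i) (p j) - sq_kernel K y z| < e / 3].
  have /cvgrPdist_lt/(_ _ d0) := @continuous_sq_kernel _ _ _ cK (p i, p j).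
  by move=> [[U V]] /= [nU nV] UV; exists (U, V); split=> // y z Uy Vz; exact: (UV (y, z)).
have [V hV] : exists V : 'I_N -> 'I_N -> set X * set X, forall i j,
    [/\ nbhs (p i) (V i j).1, nbhs (p j) (V i j).2 & forall y z,
      (V i j).1 y -> (V i j).2 z ->
      `|sq_kernel K (p i) (p j) - sq_kernel K y z| < e / 3].
  exists (fun i => projT1 (choice (cW i))) => i; exact: (projT2 (choice (cW i))).
exists (fun i => [set y | forall j, (V i j).1 y /\ (V j i).2 y]); split.
  move=> i; apply: filter_forall => j; apply: filterI.
    by have [] := hV i j.
  by have [] := hV j i.
move=> q Uq; rewrite empirical_diff_quad_form; last exact: (sq_kernelC H).
have bound i j : sq_kernel K (p i) (p j) + sq_kernel K (q i) (q j)
    - 2 * sq_kernel K (p i) (q j) <= e.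
  have [n1 n2 hd] := hV i j.
  have h1 := hd _ _ (Uq i j).1 (Uq j i).2.
  have h2 := hd _ _ (nbhs_singleton n1) (Uq j i).2.
  move: h1 h2; rewrite !ltr_norml => /andP[h1 _] /andP[_ h2]; lra.
apply: le_trans (_ : N%:R^-1 ^+ 2 * \sum_(i < N) \sum_(j < N) e <= _).
  rewrite ler_wpM2l ?sqr_ge0 //; apply: ler_sum => i _; apply: ler_sum => j _.
  exact: bound.
rewrite !sumr_const !card_ord -mulrnA -(mulr_natl e) natrM.
have [->|N0] := eqVneq N 0%N; first by rewrite !mul0r mulr0 ltW.
rewrite le_eqVlt; apply/orP; left; apply/eqP; field.
by rewrite pnatr_eq0.
Qed.

Hypothesis sc : @second_countable X.

(** The set where the error exceeds [r] contains a box around each of its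
    points. *)
Lemma reconstruction_error_measurable d (Omega : measurableType d) (x : 'I_N -> Omega -> X) (r : R) :
  (forall i, measurable_fun setT (x i : Omega -> borel X)) ->
  measurable [set w | Num.sqrt (sqn (f - rec (x ^~ w))) <= r].
Proof.
move=> mx; rewrite -[X in measurable X]setCK; apply: measurableC.
pose D := [set p : 'I_N -> X | r < Num.sqrt (sqn (f - rec p))].
have -> : ~` [set w | Num.sqrt (sqn (f - rec (x ^~ w))) <= r] = [set w | D (x ^~ w)].
  by apply/seteqP; split=> w /=; rewrite /D /= ltNge => /negP.
apply: (open_boxes_measurable sc) => // p; rewrite /D /= => Dp.
pose e := Num.sqrt (sqn (f - rec p)) - r.
have e0 : 0 < e by rewrite subr_gt0.
(* The summand 1 only makes c positive. *)
pose c := L ^+ 2 * sqn f + 1.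
have c0 : 0 < c by rewrite ltr_wpDl // mulr_ge0 ?sqr_ge0 ?sqn_ge0.
have d0 : 0 < e ^+ 2 / 2 / c by rewrite !divr_gt0 // exprn_gt0.
have [U [nU UP]] := sq_kernel_box p d0.
exists U; split=> // q /UP hq.
have : sqn (rec p - rec q) < e ^+ 2.
  apply: le_lt_trans (reconstruction_lipschitz p q) _.
  apply: le_lt_trans (_ : c * (e ^+ 2 / 2 / c) < _).
    rewrite mulrAC ler_pM //.
    - by rewrite mulr_ge0 ?sqr_ge0 ?sqn_ge0.
    - exact: (sq_kernel_psd H).
    - by rewrite lerDl.
  have -> : c * (e ^+ 2 / 2 / c) = e ^+ 2 / 2 by field; rewrite gt_eqF.
  have : 0 < e ^+ 2 by rewrite exprn_gt0.
  lra.
move=> h; have : Num.sqrt (sqn (rec p - rec q)) < e.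
  by rewrite -[ltRHS]ger0_norm ?ltW // -sqrtr_sqr ltr_sqrt // exprn_gt0.
have := sqrt_sqnD (f - rec q) (- (rec p - rec q)).
rewrite sqnN (_ : f - rec q - (rec p - rec q) = f - rec p); last first.
  by rewrite opprB addrA subrK.
rewrite {1}(_ : Num.sqrt (sqn (f - rec p)) = r + e); last by rewrite /e [RHS]addrC subrK.
lra.
Qed.

End reconstruction_regularity.

(** * Rates *)

Section rates.
Context (R : realType).
Implicit Types (alpha beta kappa l : R).

Lemma min_qual_gt0 alpha (nubar : \bar R) : 0 < alpha -> (0 < nubar)%E ->
  0 < min_qual alpha nubar.
Proof.
move=> a0; rewrite /min_qual /mine; case: nubar => [r| |] //=; last by rewrite !ltry.
by rewrite lte_fin => r0; rewrite lte_fin; case: ifP.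
Qed.

Lemma min_qual_le alpha (nubar : \bar R) : (0 < nubar)%E -> min_qual alpha nubar <= alpha.
Proof.
rewrite /min_qual /mine; case: nubar => [r| |] //=; last by rewrite !ltry.
by move=> _; rewrite lte_fin; case: ltP.
Qed.

Lemma min_qual_id alpha (nubar : \bar R) : (0 < nubar)%E ->
  min_qual (min_qual alpha nubar) nubar = min_qual alpha nubar.
Proof.
rewrite /min_qual /mine; case: nubar => [r| |] //=; last by rewrite !ltry /= ?ltry.
by move=> _; case E: (alpha%:E < r%:E)%E => /=; rewrite ?E ?ltxx.
Qed.

(** [l * g_j(l)] increases to 1. *)
Lemma spectral_le1 kappa g j l : spectral_functions kappa g ->
  0 < l <= kappa ^+ 2 -> l * g j l <= 1.
Proof.
move=> [gm gl] /andP[l0 lk].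
have c : (fun j => l * g j l) @ \oo --> (1 : R) by apply: gl; rewrite l0.
rewrite -(cvg_lim (@norm_hausdorff _ _) c).
apply: (@nondecreasing_cvgn_le _ (fun j => l * g j l)); last by apply/cvg_ex; exists 1.
apply/nondecreasing_seqP => n; rewrite ler_pM2l //.
by case/andP: (gm n l (ltW l0)).
Qed.

Lemma kappa_powR kappa a : 0 <= kappa -> (kappa ^+ 2) `^ a = kappa `^ (2 * a).
Proof. by move=> k0; rewrite powRrM powR_mulrn. Qed.

(** Of [l^alpha], the factor [l^beta] is spent on the qualification and
    [l^(alpha-beta)] is bounded on the spectrum. *)
Lemma scalar_bias kappa g (Cq : R -> R) (nubar : \bar R) alpha beta J l :
  0 < alpha -> (0 < nubar)%E -> 0 < kappa ->
  spectral_functions kappa g -> qualification kappa g nubar Cq -> (0 < J)%N ->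
  0 <= l <= kappa ^+ 2 -> beta = min_qual alpha nubar ->
  ((1 - l * g J l) * l `^ alpha) ^+ 2 <=
    (Cq beta * kappa `^ (2 * (alpha - beta)) * J%:R `^ (- beta)) ^+ 2.
Proof.
move=> a0 n0 k0 sg qg J0 /andP[l0 lk] betaE.
have b0 : 0 < beta by rewrite betaE min_qual_gt0.
have ba : beta <= alpha by rewrite betaE min_qual_le.
have [C0 q] := qg beta b0.
have r0 : 0 <= Cq beta * kappa `^ (2 * (alpha - beta)) * J%:R `^ (- beta).
  by rewrite !mulr_ge0 ?powR_ge0 // ltW.
have [->|lneq0] := eqVneq l 0.
  by rewrite powR0 ?gt_eqF // mulr0 expr0n /= sqr_ge0.
have lp : 0 < l by rewrite lt_def lneq0.
have lk' : 0 < l <= kappa ^+ 2 by rewrite lp.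
have l1 := spectral_le1 J sg lk'.
rewrite ler_pXn2r ?nnegrE //; last by rewrite mulr_ge0 ?powR_ge0 ?subr_ge0.
have -> : (1 - l * g J l) * l `^ alpha =
    l `^ (alpha - beta) * (l `^ beta * (1 - l * g J l)).
  by rewrite mulrA -powRD ?subrK ?lneq0 ?implybT // mulrC.
rewrite [Cq beta * _]mulrC -mulrA; apply: ler_pM; rewrite ?powR_ge0 //.
- by rewrite mulr_ge0 ?powR_ge0 ?subr_ge0.
- rewrite -kappa_powR; last exact: ltW.
  by apply: ge0_ler_powR; rewrite ?nnegrE ?subr_ge0 ?sqr_ge0.
- by have := q J l J0 lk'; rewrite [X in min_qual X]betaE (min_qual_id _ n0) -betaE.
Qed.

(** [N = tau^(2 beta + 2)], so both quantities are powers of [tau].  Rounding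
    costs [2^beta] since [J >= tau / 2]. *)
Lemma truncn_rate (N : nat) beta : 0 < beta -> (0 < N)%N ->
  let tau := N%:R `^ (2 * beta + 2)^-1 in
  let J := Num.truncn tau in
  let rate := N%:R `^ (- (beta / (2 * beta + 2))) in
  [/\ (0 < J)%N, J%:R `^ (- beta) <= 2 `^ beta * rate &
      J%:R ^+ 2 / N%:R <= rate ^+ 2].
Proof.
move=> b0 N0 tau J rate.
have d0 : 0 < 2 * beta + 2 by lra.
have N1 : (1 : R) <= N%:R by rewrite ler1n.
have Np : (0 : R) < N%:R by rewrite ltr0n.
have t1 : 1 <= tau.
  by rewrite -[X in X <= _](powRr0 (N%:R : R)) ler_powR // invr_ge0 ltW.
have t0 : 0 <= tau by exact: powR_ge0.
have J1 : (0 < J)%N by rewrite truncn_gt0.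
have /andP[Jt tJ] := truncn_itv t0.
have Jp : (0 : R) < J%:R by rewrite ltr0n.
have ratE : rate = tau `^ (- beta).
  by rewrite /rate /tau -powRrM; congr (_ `^ _); field; rewrite gt_eqF.
split => //.
- have tau2 : tau <= 2 * J%:R.
    apply: ltW; apply: lt_le_trans tJ _; rewrite -/J -(natr1 J).
    by rewrite mulr_natl mulr2n lerD2l ler1n.
  have h : tau `^ beta <= 2 `^ beta * J%:R `^ beta.
    rewrite -powRM //; apply: ge0_ler_powR => //; first exact: ltW.
    by rewrite nnegrE mulr_ge0.
  have tb : 0 < tau `^ beta by rewrite powR_gt0 // (lt_le_trans _ t1).
  by rewrite ratE !powRN ler_pdivlMr // mulrC ler_pdivrMr ?powR_gt0.
- apply: le_trans (_ : tau ^+ 2 / N%:R <= _).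
    by rewrite ler_pM2r ?invr_gt0 // ler_pXn2r ?nnegrE // ltW.
  rewrite ler_pdivrMr // -[tau ^+ 2]powR_mulrn // -[rate ^+ 2]powR_mulrn ?powR_ge0 //.
  rewrite /rate /tau -!powRrM -[X in _ <= _ * X](powRr1 (ltW Np)) -powRD; last first.
    by apply/implyP => _; rewrite gt_eqF.
  rewrite le_eqVlt; apply/orP; left; apply/eqP; congr (_ `^ _); field.
  by rewrite gt_eqF.
Qed.

(** [k1] and [k2 * s] are the bias and variance amplitudes; the constant is taken
    large enough to absorb both into a single product, [256 >= 128] and
    [4 v^2 >= 2 v^2]. *)
Lemma rate_combination (k1 k2 s c1 c2 rate a jn : R) : 
  0 <= k1 -> 0 <= k2 -> 0 <= s -> 0 <= c1 -> 0 <= c2 -> 0 <= rate -> 0 <= a ->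
  a <= c2 * rate -> 0 <= jn -> jn <= rate ^+ 2 ->
  2 * (c1 * k1 * a) ^+ 2 + 128 * (jn * k2 ^+ 2 * s ^+ 2) <=
  ((16 + 2 * (c2 * c1)) * (k1 + k2 * s) * rate) ^+ 2.
Proof.
move=> k10 k20 s0 c10 c20 r0 a0 ale j0 jle.
have h1 : (c1 * k1 * a) ^+ 2 <= (c1 * k1 * (c2 * rate)) ^+ 2.
  by rewrite ler_pXn2r ?nnegrE ?mulr_ge0 // ler_wpM2l ?mulr_ge0.
have h2 : jn * k2 ^+ 2 * s ^+ 2 <= rate ^+ 2 * k2 ^+ 2 * s ^+ 2.
  by rewrite !ler_wpM2r ?sqr_ge0.
apply: le_trans (_ : 2 * (c1 * k1 * (c2 * rate)) ^+ 2
   + 128 * (rate ^+ 2 * k2 ^+ 2 * s ^+ 2) <= _); first by lra.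
have -> : 2 * (c1 * k1 * (c2 * rate)) ^+ 2 + 128 * (rate ^+ 2 * k2 ^+ 2 * s ^+ 2)
  = (2 * ((c2 * c1) ^+ 2 * k1 ^+ 2) + 128 * (k2 * s) ^+ 2) * rate ^+ 2 by ring.
rewrite [leRHS]exprMn ler_wpM2r ?sqr_ge0 //.
have v0 : 0 <= c2 * c1 by rewrite mulr_ge0.
have y0 : 0 <= k2 * s by rewrite mulr_ge0.
move: (c2 * c1) (k2 * s) v0 y0 => v y v0 y0.
have vv : 0 <= v ^+ 2 by rewrite sqr_ge0.
have -> : ((16 + 2 * v) * (k1 + y)) ^+ 2 =
   2 * (v ^+ 2 * k1 ^+ 2) + 128 * y ^+ 2 +
   (2 * (v ^+ 2 * k1 ^+ 2) + 128 * y ^+ 2 + 256 * k1 ^+ 2 + 4 * (v ^+ 2 * y ^+ 2)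
     + 64 * (v * (k1 + y) ^+ 2) + 2 * (256 + 4 * v ^+ 2) * (k1 * y)) by ring.
rewrite lerDl !addr_ge0 ?mulr_ge0 ?addr_ge0 ?sqr_ge0 ?mulr_ge0 //.
Qed.

End rates.

(** * The rate of the reconstruction *)

Theorem theorem4 (R : realType) (alpha : R) (nubar : \bar R) (Cq : R -> R)
    (alpha_gt0 : 0 < alpha) (nubar_gt0 : (0 < nubar)%E) :
  let beta := min_qual alpha nubar in
  exists2 C : R, 0 < C &
  forall (X : ptopologicalType) (rho : probability (borel X) R)
    (K : X -> X -> R[i]) (kappa : R) (H : rkhs K) (T : H -> H)
    (g : nat -> R -> R),
  locally_compact_space X ->
  @second_countable X ->
  measure_support rho = setT ->
  continuous_kernel K ->
  psd_kernel K ->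
  0 < kappa ->
  (forall x, K x x <= (kappa ^+ 2)%:C) ->
  is_integral_operator rho T ->
  spectral_functions kappa g ->
  bounded_measurable_filters g ->
  qualification kappa g nubar Cq ->
  (forall j : nat,
    (j%:R : R).-lipschitz_(`[0, kappa ^+ 2]%classic) (fun l : R => l * g j l)) ->
  forall (f : H) (N : nat) (t : R),
  range (operator_power T alpha) f ->
  (1 <= N)%N ->
  0 < t ->
  forall (d : measure_display) (Omega : measurableType d)
    (P : probability Omega R) (x : 'I_N -> Omega -> X),
  iid_samples rho P x ->
  let good := [set w : Omega |
    `| f - mc_reconstruction g (x ^~ w) (N%:R `^ (2 * beta + 2)^-1) f |
    <= C%:C * `| operator_inverse (operator_power T alpha) f |
       * (kappa `^ (2 * (alpha - beta))
          + kappa `^ (2 * alpha + 2) * Num.sqrt t)%:C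
       * (N%:R `^ (- (beta / (2 * beta + 2))))%:C ] in
  measurable good /\ ((1 - 2 * expR (- t))%:E < P good)%E.
Proof.
move=> beta.
have b0 : 0 < beta by exact: min_qual_gt0.
(* The constant is fixed before the qualification makes Cq beta positive, hence
   the absolute value. *)
exists (16 + 2 * (2 `^ beta * `|Cq beta|)).
  by rewrite ltr_wpDr // !mulr_ge0 ?powR_ge0.
move=> X rho K kappa H T g _ sc _ cK _ k0 KB TI sg _ qg lip f N t [h0 _ fE] N1 t0.
move=> d Omega P x [mx law indep].
case: N N1 x mx law indep => // N _ x mx law indep.
pose tau : R := N.+1%:R `^ (2 * beta + 2)^-1.
pose rate : R := N.+1%:R `^ (- (beta / (2 * beta + 2))) => good.
pose h := operator_inverse (operator_power T alpha) f.
pose J := Num.truncn tau.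
pose k1 := kappa `^ (2 * (alpha - beta)); pose k2 := kappa `^ (2 * alpha + 2).
pose C := 16 + 2 * (2 `^ beta * `|Cq beta|).
pose B := kappa ^+ 2.
have B0 : 0 <= B by exact: sqr_ge0.
have gm := sg.1.
have hE : operator_power T alpha h = f.
  by rewrite /h /operator_inverse; case: xgetP => // /(_ h0).
pose rec w := mc_reconstruction g (x ^~ w) tau f.
pose r := C * Num.sqrt (sqn h) * (k1 + k2 * Num.sqrt t) * rate.
have goodE : good = [set w | Num.sqrt (sqn (f - rec w)) <= r].
  by apply/seteqP; split=> w /=; rewrite /good /= !norm_sqnE -!rmorphM lecR.
have phiL (l m : R) : 0 <= l <= B -> 0 <= m <= B ->
    (l * g J l - m * g J m) ^+ 2 <= J%:R ^+ 2 * (l - m) ^+ 2.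
  move=> lB mB; have := lip J (l, m).
  rewrite /= => /(_ _); rewrite !in_itv /= => /(_ (conj lB mB)) hl.
  rewrite -exprMn -[leLHS]real_normK ?num_real // -[leRHS]real_normK ?num_real //.
  rewrite ler_pXn2r ?nnegrE // (le_trans hl) // normrM ger0_norm //.
have mgood : measurable good.
  by rewrite goodE; exact: (reconstruction_error_measurable B0 KB gm phiL f cK sc r mx).
split => //.
pose W := (sq_kernel K : borel X -> borel X -> R).
pose Wc := centered rho W.
have WC : forall y z : borel X, W y z = W z y by exact: (sq_kernelC H).
have Wb := bounded_mfun_sq_kernel H cK KB.
have kWb := bounded_mfun_kmean rho H sc cK KB.
have Wdiag := centered_diag_bound rho H sc cK KB.
have Wpsd := centered_sq_kernel_psd rho H sc cK KB.
pose M := 2 * B ^+ 2.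
have M0 : 0 < M by rewrite mulr_gt0 ?exprn_gt0.
have Wm : measurable_fun setT (fun p : borel X * borel X => Wc p.1 p.2).
  rewrite /Wc /centered; apply: measurable_funD; last exact: measurable_cst.
  apply: measurable_funB.
    apply: measurable_funB; first exact: measurable_sq_kernel2.
    by apply: (measurableT_comp kWb.1); exact: measurable_fst.
  by apply: (measurableT_comp kWb.1); exact: measurable_snd.
have WcC := centeredC rho WC.
have Wcb := centered_bounded Wb kWb.
have Wc0 := mean_centered (rho := rho) Wb kWb.
pose xb : 'I_N.+1 -> Omega -> borel X := x.
pose A := [set w | 16 * N.+1%:R * M * t <= sample_energy xb Wc (enum 'I_N.+1) w].
have mA : measurable A by exact: (measurable_energy_ge mx Wm).
have PA : (P A < (2 * expR (- t))%:E)%E.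
  exact: (energy_tail mx law indep WcC Wm Wcb Wpsd Wc0 M0 Wdiag (ltn0Sn N) (ltW t0)).
suff sub : ~` A `<=` good.
  have : (P (~` A) <= P good)%E.
    by apply: le_measure; rewrite ?inE //; exact: measurableC.
  apply: lt_le_trans; rewrite probability_setC // EFinB.
  by rewrite lteD2lE // lteN2.
move=> w /= /negP; rewrite -ltNge => sw; rewrite goodE /=.
pose q := quad_form Wc (empirical N.+1%:R^-1 (x ^~ w)).
have Np : (0 : R) < N.+1%:R by rewrite ltr0n.
(* q is the energy divided by the squared sample size, and M = 2 B^2. *)
have qE : q <= 32 * B ^+ 2 * t / N.+1%:R.
  have -> : q = N.+1%:R^-1 ^+ 2 * sample_energy xb Wc (enum 'I_N.+1) w.
    rewrite /q /sample_energy /quad_form !big_map mulr_sumr; apply: eq_bigr => i _.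
    rewrite !big_map mulr_sumr; apply: eq_bigr => j _ /=; ring.
  apply: le_trans (_ : N.+1%:R^-1 ^+ 2 * (16 * N.+1%:R * M * t) <= _).
    by rewrite ler_wpM2l ?sqr_ge0 // ltW.
  rewrite le_eqVlt; apply/orP; left; apply/eqP; rewrite /M; field.
  by rewrite gt_eqF.
suff main : sqn (f - rec w) <= sqn h *
   (2 * (`|Cq beta| * k1 * J%:R `^ (- beta)) ^+ 2
    + 128 * (J%:R ^+ 2 / N.+1%:R * k2 ^+ 2 * Num.sqrt t ^+ 2)).
  have [J0 rate1 rate2] := truncn_rate b0 (ltn0Sn N).
  have r0 : 0 <= r.
    by rewrite !mulr_ge0 ?sqrtr_ge0 ?addr_ge0 ?mulr_ge0 ?powR_ge0 ?sqrtr_ge0.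
  rewrite -[leRHS]ger0_norm // -sqrtr_sqr ler_wsqrtr //; apply: le_trans main _.
  have -> : r ^+ 2 = sqn h * (C * (k1 + k2 * Num.sqrt t) * rate) ^+ 2.
    rewrite /r -[in RHS](sqr_sqrtr (sqn_ge0 h)); ring.
  rewrite ler_wpM2l ?sqn_ge0 //.
  apply: rate_combination; rewrite ?powR_ge0 ?sqrtr_ge0 //.
have [J0 _ _] := truncn_rate b0 (ltn0Sn N).
(* Without a resolution in which the series of T^alpha h converges, the calculus
   takes its default value 0; the reconstruction of 0 is 0. *)
have [f0|[lam [E [resE src]]]] : f = 0 \/ exists lam E, spectral_resolution T lam E /\
    series (fun n => (lam n `^ alpha)%:C *: E n h) @ \oo --> f.
- have := hE; rewrite /operator_power /spectral_calculus.
  case: xgetP => [f' -> [lam [E [resE src]]] <-|_ <-]; last by left.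
  by right; exists lam, E.
- have -> : f - rec w = 0.
    have [mu [F [resF muB finF]]] :=
      @empirical_resolution _ _ _ H _ (x ^~ w) B B0 (fun i => KB (x i w)).
    apply: (res_ext resF) => n; rewrite (linB _ _ (res_lin resF n)).
    rewrite (proj_reconstruction _ _ resF finF gm); last by case/andP: (muB n).
    by rewrite f0 (lin0 (res_lin resF n)) scaler0 subr0.
  rewrite sqn0; apply: mulr_ge0; first exact: sqn_ge0.
  apply: addr_ge0; first by rewrite mulr_ge0 ?sqr_ge0.
  by rewrite /k2 !mulr_ge0 ?invr_ge0 ?powR_ge0 ?sqrtr_ge0 ?ler0n.
have lamB n v : E n v != 0 -> 0 <= lam n <= B.
  move=> e0; apply: (integral_operator_eig_bound sc cK B0 KB TI e0).
  exact: (res_apply_proj resE).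
have k0' : 0 <= kappa by exact: ltW.
have fh : sqn f <= (kappa `^ (2 * alpha)) ^+ 2 * sqn h.
  apply: (source_norm (psi := fun l => l `^ alpha) resE lamB src) => l /andP[l0 lB].
  rewrite ler_pXn2r ?nnegrE ?powR_ge0 // -kappa_powR //.
  by apply: (ge0_ler_powR (ltW alpha_gt0)); rewrite ?nnegrE.
have stab M' := @reconstruction_stability _ _ _ _ _ B0 KB _ _ _ gm phiL f _ _ _ _ _
  (x ^~ w) M' resE lamB (integral_operator_hs sc cK B0 KB TI (x ^~ w)).
have bias l : 0 <= l <= B -> ((1 - l * g J l) * l `^ alpha) ^+ 2 <=
    (`|Cq beta| * k1 * J%:R `^ (- beta)) ^+ 2.
  move=> lB; have [C0 _] := qg beta b0; rewrite (gtr0_norm C0).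
  exact: (scalar_bias alpha_gt0 nubar_gt0 k0 sg qg J0 lB (erefl beta)).
apply: le_trans (error_split (psi := fun l => l `^ alpha) resE lamB src bias stab) _.
have k2E : k2 ^+ 2 = (kappa `^ (2 * alpha)) ^+ 2 * B ^+ 2.
  rewrite /k2 powRD; last by apply/implyP => _; rewrite gt_eqF.
  by rewrite powR_mulrn // exprMn.
have t2 : Num.sqrt t ^+ 2 = t by rewrite sqr_sqrtr // ltW.
have q0 : 0 <= q by exact: Wpsd.
have fin : J%:R ^+ 2 * (2 * q) * sqn f <=
    J%:R ^+ 2 * (2 * (32 * B ^+ 2 * t / N.+1%:R)) * ((kappa `^ (2 * alpha)) ^+ 2 * sqn h).
  by rewrite ler_pM ?mulr_ge0 ?sqr_ge0 ?sqn_ge0 // ler_wpM2l ?sqr_ge0 // ler_pM2l.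
rewrite t2 k2E.
set u := `|Cq beta| * k1 * J%:R `^ (- beta) in bias *.
have -> : sqn h * (2 * u ^+ 2 + 128 * (J%:R ^+ 2 / N.+1%:R
     * ((kappa `^ (2 * alpha)) ^+ 2 * B ^+ 2) * t))
  = 2 * u ^+ 2 * sqn h + 2 * (J%:R ^+ 2 * (2 * (32 * B ^+ 2 * t / N.+1%:R))
     * ((kappa `^ (2 * alpha)) ^+ 2 * sqn h)) by ring.
by rewrite lerD2l ler_pM2l.
Qed.
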